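(* Let $q$ be a prime power and $M\geq 2$ an integer. Let $S_U^M(n,q)$ denote the number of separable matrices in $\mathrm{U}(n,\mathbb{F}_{q^2})$ which are $M$-th powers in $\mathrm{U}(n,\mathbb{F}_{q^2})$. Then \[ 1+\sum_{n\geq 1}\frac{S_U^M(n,q)}{|\mathrm{U}(n,\mathbb{F}_{q^2})|}z^n=\prod_{d\ \text{odd}}\left(1+\frac{z^d}{q^d+1}\right)^{\widetilde{N}_M(q,d)}\prod_{d\geq 1}\left(1+\frac{z^{2d}}{q^{2d}-1}\right)^{\widetilde{R}_M(q,d)}, \] where the first product is over odd positive integers $d$.
   Context: For $a\in\mathbb{F}_{q^2}$ write $\bar a=a^q$, extended coefficientwise to matrices and polynomials. Let $\Lambda_n$ be the $n\times n$ antidiagonal matrix with $1$'s on the antidiagonal; $\mathrm{U}(n,\mathbb{F}_{q^2})=\{A\in \mathrm{GL}(n,\mathbb{F}_{q^2}) : A\Lambda_n\bar A^{t}=\Lambda_n\}$. An element $A$ is an $M$-th power in $\mathrm{U}(n,\mathbb{F}_{q^2})$ if $A=\alpha^M$ for some $\alpha\in\mathrm{U}(n,\mathbb{F}_{q^2})$. A matrix is separable if its characteristic polynomial has no repeated roots. For monic $f$ of degree $d$ with $f(0)\ne0$, $\widetilde{f}(t)=\overline{f(0)}^{-1}t^d\bar f(t^{-1})$. A SCIM polynomial is a monic $f\in\mathbb{F}_{q^2}[t]$, $f(0)\neq 0$, irreducible over $\mathbb{F}_{q^2}$, with $\widetilde f=f$. A SCIM polynomial $f$ of degree $d$ is $\widetilde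 M$-power if $f(x^M)$ has a SCIM factor of degree $d$; $\widetilde N_M(q,d)$ is the number of $\widetilde M$-power SCIM polynomials of degree $d$. A monic irreducible $g\in\mathbb{F}_{q^2}[t]$ of degree $d$ with $g(0)\ne 0$ is an $M$-power polynomial if $g(x^M)$ has an irreducible factor of degree $d$ over $\mathbb{F}_{q^2}$. $\widetilde R_M(q,d)$ is the number of unordered pairs $\{g,\widetilde g\}$ where $g$ is monic irreducible of degree $d$ over $\mathbb{F}_{q^2}$ with $g(0)\neq0$, $g\neq\widetilde g$, and $g$ an $M$-power polynomial. *)

(* Defs.v *)
From HB Require Import structures.
From mathcomp Require Import all_boot all_order all_algebra all_field.
From mathcomp Require Import boolp.
Set Implicit Arguments.
Unset Strict Implicit.
Unset Printing Implicit Defensive.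
Import GRing.Theory.
Local Open Scope ring_scope.

(* Conjugation a |-> a^q on F = F_{q^2} (we assume #|F| = q^2 in the theorem). *)
Definition bar (F : finFieldType) (q : nat) (a : F) : F := a ^+ q.

Definition antidiag (F : finFieldType) (n : nat) : 'M[F]_n :=
  \matrix_(i < n, j < n) (((i + j)%N == n.-1) : nat)%:R.

Definition unitaryb (F : finFieldType) (q n : nat) (A : 'M[F]_n) : bool :=
  (A \in unitmx) && (A *m antidiag F n *m (map_mx (bar q) A)^T == antidiag F n).

Definition Ugroup (F : finFieldType) (q n : nat) : {set 'M[F]_n} :=
  [set A | unitaryb q A].

Definition is_Mth_power_U (F : finFieldType) (q M n : nat) (A : 'M[F]_n) : bool :=
  [exists a : 'M[F]_n, unitaryb q a && (a ^+ M == A)].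

Definition separable_mx (F : finFieldType) (n : nat) (A : 'M[F]_n) : bool :=
  separable_poly (char_poly A).

Definition S_U (F : finFieldType) (q M n : nat) : nat :=
  #|[set A : 'M[F]_n | [&& unitaryb q A, separable_mx A & is_Mth_power_U q M A]]|.

(* f~(t) = conj(f(0))^{-1} t^d fbar(t^{-1}), d = deg f. *)
Definition ptilde (F : finFieldType) (q : nat) (f : {poly F}) : {poly F} :=
  (bar q (f`_0))^-1 *: \poly_(i < size f) bar q (f`_((size f).-1 - i)).

Definition SCIM (F : finFieldType) (q : nat) (f : {poly F}) : Prop :=
  [/\ f \is monic, f`_0 != 0, irreducible_poly f & ptilde q f = f].

Definition tildeM_power (F : finFieldType) (q M : nat) (f : {poly F}) : Prop :=
  exists g : {poly F}, [/\ SCIM q g, size g = size f & g %| f \Po 'X^M].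

Definition M_power_poly (F : finFieldType) (M : nat) (g : {poly F}) : Prop :=
  exists h : {poly F}, [/\ irreducible_poly h, size h = size g & h %| g \Po 'X^M].

Definition monic_of (F : finFieldType) (d : nat) (t : d.-tuple F) : {poly F} :=
  'X^d + \poly_(i < d) t`_i.

Definition tuple_of_poly (F : finFieldType) (d : nat) (p : {poly F}) : d.-tuple F :=
  [tuple p`_i | i < d].

Definition Ntilde (F : finFieldType) (q M d : nat) : nat :=
  #|[set t : d.-tuple F | `[< SCIM q (monic_of t) /\ tildeM_power q M (monic_of t) >]]|.

Definition Rtilde (F : finFieldType) (q M d : nat) : nat :=
  #|[set [set t; tuple_of_poly d (ptilde q (monic_of t))] |
      t in [set t : d.-tuple F |
        `[< [/\ irreducible_poly (monic_of t), (monic_of t)`_0 != 0,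
               monic_of t != ptilde q (monic_of t) &
               M_power_poly M (monic_of t)] >]]]|.

Definition lhs_coef (F : finFieldType) (q M n : nat) : rat :=
  if n == 0%N then 1 else (S_U F q M n)%:R / (#|Ugroup F q n|)%:R.

(* Right-hand side infinite product truncated to the factors with d <= n;
   the remaining factors are = 1 modulo z^(n+1), so the coefficient of z^n
   of the infinite product equals the coefficient of z^n of this polynomial. *)
Definition rhs_trunc (F : finFieldType) (q M n : nat) : {poly rat} :=
  (\prod_(1 <= d < n.+1 | odd d)
      (1 + ((q%:R ^+ d + 1)^-1 : rat) *: 'X^d) ^+ Ntilde F q M d) *
  (\prod_(1 <= d < n.+1)
      (1 + ((q%:R ^+ (2 * d) - 1)^-1 : rat) *: 'X^(2 * d)) ^+ Rtilde F q M d).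

(* Main.v *)
(* Write sigma x = x^(-q) on a finite extension L of F.  The root sets of
   separable self-dual polynomials over F are exactly the finite sigma-stable
   sets Z of nonzero elements, because sigma^2 is the Frobenius of F.  A unitary
   matrix with eigenvalue set Z is diagonalised by a matrix W with
   W J W^dagger = S, where S is the permutation matrix of sigma on Z; the set of
   such W is one coset of the unitary group, and W is unique up to the torus of
   sigma-equivariant maps t : Z -> L^*.  Hence the class of Z has |U| / |T_Z|
   elements, and its members are M-th powers in U iff x = t(x)^M for some t in
   T_Z.  Both |T_Z| and this last condition factor over the sigma-orbits in Z:
   an orbit of size m contributes q^m - (-1)^m.  Orbits of odd size d are the
   root sets of SCIM polynomials of degree d, orbits of size 2d are those of the
   products g * ptilde g with g <> ptilde g irreducible of degree d. *)
Require Import Defs.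
From HB Require Import structures.
From mathcomp Require Import fingroup perm.
From mathcomp Require Import all_boot all_order all_algebra all_field zify.
From mathcomp Require Import boolp.
Set Implicit Arguments.
Unset Strict Implicit.
Unset Printing Implicit Defensive.
Import GRing.Theory.
Local Open Scope ring_scope.

(** * Splitting fields *)

(** A single finite field [L], chosen for each n, stands in for an algebraic closure: it splits all
    polynomials over [F] of degree at most n and contains the roots of unity needed for norm
    equations. Counting may be done over [L]: taking the dagger of A J A^dagger = J shows that the
    entries of A are fixed by x -> x^(q^2), hence lie in [F], so [L] adds no unitary matrix. The
    matrices W do live over [L], where the dagger is no longer an involution, and this is the main
    obstacle: the Gram matrix of J in an eigenbasis need not be hermitian. Existence of W for a
    given Z is therefore settled over [F], where all nondegenerate hermitian forms are congruent.
    That every A in the class comes from some W is a separate matter: eigenvectors are normalised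
    compatibly with Frobenius, and one norm equation per odd cycle of sigma remains. The sign in q^m
    - (-1)^m comes from the inversion in sigma: a nonzero y is fixed after m steps iff y^(q^m + 1) =
    1 for odd m, and iff y^(q^m - 1) = 1 for even m. *)

Definition splits (K : fieldType) (p : {poly K}) : Prop :=
  exists rs : seq K, p %= \prod_(r <- rs) ('X - r%:P).

Section Splitting.
Variable K : fieldType.
Implicit Types p g : {poly K}.

Lemma splits_dvd p g : splits p -> g %| p -> splits g.
Proof.
case=> rs Dp g_p; have: g %| \prod_(r <- rs) ('X - r%:P) by rewrite -(eqp_dvdr _ Dp).
by case/dvdp_prod_XsubC=> m Dg; exists (mask m rs).
Qed.

Lemma splits_root p : splits p -> size p != 1 -> exists x, root p x.
Proof.
case=> -[|r rs] Dp; first by rewrite (eqp_size Dp) big_nil size_poly1.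
by exists r; rewrite (eqp_root Dp) big_cons rootM root_XsubC eqxx.
Qed.
End Splitting.

Section FiniteSplitting.
Variable L : finFieldType.
Implicit Types p g : {poly L}.

Definition roots_of p := [set x : L | root p x].

Lemma splits_prod p : splits p -> separable_poly p -> p \is monic ->
  p = \prod_(x in roots_of p) ('X - x%:P).
Proof.
move=> [rs Dp] sep mon; have mon' := monic_prod_XsubC rs xpredT id.
have{}Dp : p = \prod_(r <- rs) ('X - r%:P) by apply/eqP; rewrite -eqp_monic.
have urs : uniq rs by rewrite -separable_prod_XsubC -Dp.
rewrite {1}Dp (big_uniq _ urs); apply: eq_bigl => x.
by rewrite inE Dp root_prod_XsubC.
Qed.

Lemma roots_of_prod (A : {set L}) :
  roots_of (\prod_(x in A) ('X - x%:P)) = A.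
Proof.
apply/setP=> x; rewrite inE -big_enum root_prod_XsubC.
by rewrite mem_enum.
Qed.

Lemma separable_prod_set (A : {set L}) :
  separable_poly (\prod_(x in A) ('X - x%:P)).
Proof. by rewrite -big_enum separable_prod_XsubC enum_uniq. Qed.

Lemma size_prod_set (A : {set L}) :
  size (\prod_(x in A) ('X - x%:P)) = #|A|.+1.
Proof. by rewrite -big_enum size_prod_XsubC cardE. Qed.

Lemma splits_card p : splits p -> separable_poly p ->
  #|roots_of p| = (size p).-1.
Proof.
move=> spl sep; have p0 := separable_poly_neq0 sep.
have lc0: lead_coef p != 0 by rewrite lead_coef_eq0.
have Ep := eqp_scale p (invr_neq0 lc0); set p' := _ *: p in Ep.
have mon : p' \is monic by rewrite monicE lead_coefZ mulVf.
have spl' : splits p' by apply: splits_dvd spl _; rewrite (eqp_dvdl _ Ep).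
have sep' : separable_poly p' by rewrite (eqp_separable Ep).
have -> : roots_of p = roots_of p'.
  by apply/setP=> x; rewrite !inE (eqp_root Ep).
by rewrite -(eqp_size Ep) [in RHS](splits_prod spl' sep' mon) size_prod_set.
Qed.

Lemma dvd_Xn_sub_1 (k l : nat) (c : L) : c ^+ l = 1 ->
  'X^k - c%:P %| ('X^(k * l) - 1 : {poly L}).
Proof.
move=> cl; have -> : 'X^(k * l) - 1 = ('X^k) ^+ l - c%:P ^+ l :> {poly L}.
  by rewrite -exprM -rmorphXn cl.
by rewrite subrXX dvdp_mulIl.
Qed.

(** This solves every norm equation below: [X^k - c] divides [X^(k l) - 1], so it has a root once
    the latter splits, without appeal to the cyclicity of the multiplicative group. *)
Lemma splits_unity_root (k l : nat) (c : L) :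
  splits ('X^(k * l) - 1 : {poly L}) -> (0 < k)%N -> c ^+ l = 1 ->
  exists a, a ^+ k = c.
Proof.
move=> spl k0 cl.
have [|a] := splits_root (splits_dvd spl (dvd_Xn_sub_1 k cl)).
  by rewrite size_XnsubC // eqSS -lt0n.
by rewrite /root !hornerE subr_eq0 => /eqP; exists a.
Qed.

Lemma splits_card_unity (k l : nat) :
  splits ('X^(k * l) - 1 : {poly L}) -> (k%:R : L) != 0 ->
  #|[set x : L | x ^+ k == 1]| = k.
Proof.
move=> spl k0; have k_gt0 : (0 < k)%N by case: k k0 {spl}; rewrite ?eqxx.
have := splits_card (splits_dvd spl (dvd_Xn_sub_1 k (expr1n _ _))).
rewrite separable_Xn_sub_1 // => /(_ isT).
rewrite size_XnsubC //= => {2}<-; apply: eq_card => x.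
by rewrite !inE /root !hornerE subr_eq0.
Qed.
End FiniteSplitting.

Lemma finField_splits (F : finFieldType) (p : {poly F}) : p != 0 ->
  exists (L : finFieldType) (iota : {rmorphism F -> L}),
    splits (map_poly iota p).
Proof.
move=> /FinSplittingFieldFor [L [rs Dp _]].
by exists (FinFieldExtType L), (in_alg L); exists rs.
Qed.

Section MonicTuples.
Variables (F : finFieldType) (d : nat).

Lemma monic_of_monic (t : d.-tuple F) : monic_of t \is monic.
Proof.
rewrite /monic_of monicE lead_coefDl ?lead_coefXn //.
by rewrite size_polyXn ltnS size_poly.
Qed.

Lemma size_monic_of (t : d.-tuple F) : size (monic_of t) = d.+1.
Proof. by rewrite /monic_of size_polyDl size_polyXn // ltnS size_poly. Qed.

Lemma tuple_of_polyK (p : {poly F}) : p \is monic -> size p = d.+1 ->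
  monic_of (tuple_of_poly d p) = p.
Proof.
move=> mon szp; apply/polyP=> i; rewrite coefD coefXn coef_poly.
case: (ltngtP i d) => [lti|gti|->]; rewrite ?add0r ?addr0.
- by rewrite -(tnth_nth 0 _ (Ordinal lti)) tnth_mktuple.
- by rewrite nth_default // szp.
- by move/eqP: mon; rewrite lead_coefE szp.
Qed.

Lemma monic_ofK (t : d.-tuple F) : tuple_of_poly d (monic_of t) = t.
Proof.
apply: eq_from_tnth => i; rewrite tnth_mktuple coefD coefXn coef_poly ltn_ord.
by rewrite ltn_eqF ?ltn_ord // add0r -tnth_nth.
Qed.
End MonicTuples.

(** * The extension field L *)

Section BarField.
Variables (F : finFieldType) (q : nat) (hF : #|F| = (q ^ 2)%N).

Lemma q_gt1 : (1 < q)%N.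
Proof.
by have := finNzRing_gt1 F; rewrite hF; case: q => [|[|]].
Qed.

Lemma q_pchar : [pchar F].-nat q.
Proof.
have [p pr_p cF] := finPcharP F.
have : p.-nat #|F|.
  by have := card_pprimeChar cF; rewrite /pPrimeCharType => ->; rewrite pnatX pnat_id.
rewrite hF pnatX orbF; apply: sub_in_pnat => r _.
by rewrite inE => /eqP->.
Qed.

Lemma q_pchar_ext (L : finFieldType) (iota : {rmorphism F -> L}) :
  [pchar L].-nat q.
Proof.
by move: q_pchar; apply: sub_in_pnat => r _; apply: rmorph_pchar.
Qed.

Lemma natr_q (L : finFieldType) (iota : {rmorphism F -> L}) : q%:R = 0 :> L.
Proof.
have : (#|F|%:R : F) = 0.
  (* Translation by 1 permutes [F], so the sum of |F| ones vanishes and q^2 = 0 in [F]. *)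
  have : \sum_(x : F) (x + 1) = \sum_(x : F) x by rewrite [RHS](reindex_inj (addIr 1)).
  by rewrite big_split sumr_const /= -[RHS]addr0 => /addrI.
rewrite hF natrX => /eqP; rewrite expf_eq0 /= => /eqP q0.
by rewrite -(rmorph_nat iota) q0 rmorph0.
Qed.

(** Only finitely many polynomials matter for a given n, so their product has one finite splitting
    field. The second clause puts the fields of order q^(2d), d <= n, inside [L]. *)
Lemma extension_exists (n : nat) :
  exists (L : finFieldType) (iota : {rmorphism F -> L}),
    (forall p : {poly F}, p != 0 -> (size p <= n.+1)%N ->
       splits (map_poly iota p)) /\
    (forall d, (0 < d <= n)%N -> splits ('X^(q ^ (2 * d) - 1) - 1 : {poly L})).
Proof.
pose P1 := \prod_(t : n.-tuple F) monic_of t.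
pose P2 := \prod_(d < n.+1 | (0 < d)%N) ('X^(q ^ (2 * d) - 1) - 1 : {poly F}).
have N0 d : (0 < d)%N -> (0 < q ^ (2 * d) - 1)%N.
  move=> d0; rewrite subn_gt0; apply: leq_trans (ltn_expl _ q_gt1).
  by rewrite ltnS muln_gt0.
have P0 : P1 * P2 != 0.
  apply: mulf_neq0; first by apply/prodf_neq0 => t _; apply/monic_neq0/monic_of_monic.
  apply/prodf_neq0 => d d0.
  by rewrite -size_poly_gt0 size_XnsubC ?N0.
have [L [iota spl]] := finField_splits P0.
exists L, iota; split=> [p p0 sp | d /andP[d0 dn]].
  (* Normalising and padding with a power of X makes p monic of degree exactly n, hence one of the
     factors of [P1]. *)
  pose p' := (lead_coef p)^-1 *: p * 'X^(n.+1 - size p).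
  have lc0: lead_coef p != 0 by rewrite lead_coef_eq0.
  have mon : p' \is monic.
    by rewrite monicE lead_coef_Mmonic ?monicXn // lead_coefZ mulVf.
  have szp' : size p' = n.+1.
    rewrite size_Mmonic ?monicXn ?scaler_eq0 ?invr_eq0 ?(negPf lc0) //.
    by rewrite size_scale ?invr_eq0 // size_polyXn addnS /= subnKC.
  pose t := tuple_of_poly n p'.
  have Dt : monic_of t = p' by apply: tuple_of_polyK.
  apply: splits_dvd spl _; rewrite dvdp_map.
  apply: dvdp_mulr; rewrite /P1 (bigD1 t) //= Dt; apply: dvdp_mulr.
  by apply: dvdp_mulr; rewrite dvdpZr ?invr_eq0.
apply: splits_dvd spl _.
have -> : 'X^(q ^ (2 * d) - 1) - 1 = map_poly iota ('X^(q ^ (2 * d) - 1) - 1).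
  by rewrite rmorphB /= map_polyXn rmorph1.
rewrite dvdp_map; apply: dvdp_mull; rewrite /P2.
have dn' : (d < n.+1)%N by [].
by rewrite (bigD1 (Ordinal dn')) //=; apply: dvdp_mulr.
Qed.
End BarField.

(** * Equivariant maps on the orbits of an injection *)

Section OrbitSections.
Variables (T : finType) (f : T -> T) (injf : injective f).

Lemma froot_succ x : froot f (f x) = froot f x.
Proof.
by apply/eqP; rewrite eq_sym root_connect ?fconnect1 //; apply: fconnect_sym.
Qed.

Lemma fconnect_froot x : fconnect f (froot f x) x.
Proof. by rewrite fconnect_sym // connect_root. Qed.

Lemma iter_froot x : iter (findex f (froot f x) x) f (froot f x) = x.
Proof. exact: iter_findex (fconnect_froot x). Qed.

Lemma order_froot x : order f (froot f x) = order f x.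
Proof.
by apply: esym; apply: eq_card; apply: same_connect (connect_root _ _);
  apply: fconnect_sym.
Qed.

(** The second case is the wrap-around at the end of a cycle, the only place where a recursion along
    an orbit has a compatibility to meet. *)
Lemma findex_succ x : let r := froot f x in
  findex f r (f x) = (findex f r x).+1 \/
  [/\ f x = r, findex f r (f x) = 0%N & (findex f r x).+1 = order f r].
Proof.
move=> r; have ltk := findex_max (fconnect_froot x).
have Dfx : f x = iter (findex f r x).+1 f r by rewrite iterS iter_froot.
have [lt|] := ltnP (findex f r x).+1 (order f r).
  by left; rewrite {1}Dfx findex_iter.
move=> ge; have E : (findex f r x).+1 = order f r by apply/eqP; rewrite eqn_leq ltk.
by right; split=> //; rewrite Dfx E iter_order ?findex0.
Qed.

(** The value at the root of an orbit propagates along it, and the hypothesis says that it returns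
    to itself after one full turn. As [step] may depend on the point, the iteration carries the pair
    of current point and current value. *)
Lemma equivariant_section (Y : Type) (step : T -> Y -> Y) (a : T -> Y) :
    (forall r, froot f r = r ->
       iter (order f r) (fun u => (f u.1, step u.1 u.2)) (r, a r) = (r, a r)) ->
  exists t : T -> Y, (forall r, froot f r = r -> t r = a r) /\
                     (forall x, t (f x) = step x (t x)).
Proof.
set phi := fun u => _ => closed.
pose u x := iter (findex f (froot f x) x) phi (froot f x, a (froot f x)).
have u1 x : (u x).1 = x.
  rewrite -[RHS]iter_froot /u.
  by elim: (findex f _ x) => [|k IH] //=; rewrite IH.
have rr x : froot f (froot f x) = froot f x by apply: root_root; apply: fconnect_sym.
exists (fun x => (u x).2); split=> [r Dr | x]; first by rewrite /u Dr findex0.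
transitivity (phi (u x)).2; last by rewrite /= u1.
congr _.2; rewrite {1}/u froot_succ; case: (findex_succ x) => [-> // | [_ -> E]].
by rewrite /= -[LHS](closed _ (rr x)) -E.
Qed.

Variables (D : {set T}) (x0 : T) (fD : forall x, (f x \in D) = (x \in D)).

(** The default [x0] off [A] makes each map on [A] count exactly once as a finite function. With
    sigma for [f] and the nonzero elements for [D], this is the torus of the overview. *)
Definition equivariant_maps (A : {set T}) : {set {ffun T -> T}} :=
  [set phi : {ffun T -> T} | [forall x, if x \in A then (phi x \in D) && (phi (f x) == f (phi x))
                        else phi x == x0]].

(** Such a map is determined by its values at the orbit roots in [A], and there any point of [D]
    whose period divides the orbit size is allowed. *)
Lemma card_equivariant_maps (A : {set T}) :
    (forall x, (f x \in A) = (x \in A)) ->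
  #|equivariant_maps A| =
  \prod_(r in A | froot f r == r) #|[set y in D | iter (order f r) f y == y]|.
Proof.
move=> fA; have rA x : (froot f x \in A) = (x \in A).
  have it k y : (iter k f y \in A) = (y \in A) by elim: k => //= k IH; rewrite fA.
  by rewrite -{2}[x]iter_froot it.
have itD k y : (iter k f y \in D) = (y \in D) by elim: k => //= k IH; rewrite fD.
have rr x : froot f (froot f x) = froot f x by apply: root_root; apply: fconnect_sym.
pose G r : {set T} := if (r \in A) && (froot f r == r) then
  [set y in D | iter (order f r) f y == y] else [set x0].
pose E (psi : {ffun T -> T}) := [ffun x => if x \in A then
  iter (findex f (froot f x) x) f (psi (froot f x)) else x0].
have memG x psi : psi \in family (fun r => mem (G r)) -> x \in A ->
    psi (froot f x) \in D /\ iter (order f (froot f x)) f (psi (froot f x)) = psi (froot f x).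
  move=> /familyP/(_ (froot f x)) + xA; rewrite /G rA xA rr eqxx !inE.
  by case/andP=> ? /eqP.
have -> : equivariant_maps A = [set E psi | psi in family (fun r => mem (G r))].
  apply/setP=> phi; apply/idP/imsetP=> [|[psi Gpsi ->]].
    rewrite inE => /forallP phiP; pose psi := [ffun r =>
      if (r \in A) && (froot f r == r) then phi r else x0].
    have eqvk k x : x \in A -> phi (iter k f x) = iter k f (phi x).
      move=> xA; elim: k => //= k <-; have:= phiP (iter k f x).
      suff -> : iter k f x \in A by case/andP=> _ /eqP.
      by elim: k => //= k; rewrite fA.
    exists psi.
      apply/familyP=> r; rewrite ffunE /G; case: ifP => [/andP[rA' /eqP rr']|_]; rewrite !inE //.
      by have:= phiP r; rewrite rA' => /andP[-> _] /=; rewrite -eqvk // iter_order.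
    apply/ffunP=> x; rewrite !ffunE; case: ifPn => xA; last first.
      by have:= phiP x; rewrite (negPf xA) => /eqP.
    by rewrite rA xA rr eqxx /= -eqvk ?rA // iter_froot.
  rewrite inE; apply/forallP=> x; rewrite !ffunE fA; case: ifPn => xA; last by rewrite (negPf xA).
  have [psiD psi_it] := memG _ _ Gpsi xA.
  rewrite !xA itD psiD froot_succ; case: (findex_succ x) => [-> //= | [_ -> e]].
  by rewrite /= -iterS e psi_it.
rewrite card_in_imset => [|psi1 psi2 G1 G2 /ffunP eqE].
  rewrite card_family foldrE big_map big_enum /= big_mkcond /=.
  rewrite [RHS]big_mkcond; apply: eq_bigr => r _; rewrite /G.
  by case: ifP; rewrite ?cards1.
apply/ffunP=> r; case rP: ((r \in A) && (froot f r == r)).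
  have:= eqE r; rewrite !ffunE; case/andP: rP => -> /eqP ->.
  by rewrite findex0.
by have:= (familyP G1 r, familyP G2 r); rewrite /G rP !inE => -[/eqP-> /eqP->].
Qed.

End OrbitSections.

(** * Hermitian matrices over F *)

(** The proof argument [hq], by which q is a power of the characteristic, is what allows [bar q] to
    be registered as a ring morphism. *)
Definition qfrob (K : finFieldType) (q : nat) (hq : [pchar K].-nat q) : K -> K :=
  bar q.

Section QFrob.
Variables (K : finFieldType) (q : nat) (hq : [pchar K].-nat q).

Fact qfrob_zmod_morphism : zmod_morphism (qfrob hq).
Proof.
by move=> x y; rewrite /qfrob /bar exprDn_pchar // exprNn_pchar.
Qed.

Fact qfrob_monoid_morphism : monoid_morphism (qfrob hq).
Proof. by split=> [|x y]; rewrite /qfrob /bar ?expr1n ?exprMn. Qed.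
End QFrob.

HB.instance Definition _ (K : finFieldType) (q : nat) (hq : [pchar K].-nat q) :=
  GRing.isZmodMorphism.Build K K (qfrob hq) (qfrob_zmod_morphism hq).
HB.instance Definition _ (K : finFieldType) (q : nat) (hq : [pchar K].-nat q) :=
  GRing.isMonoidMorphism.Build K K (qfrob hq) (qfrob_monoid_morphism hq).

(** Conjugate transpose with the exponent q kept on every field: over [F] it is an involution, over
    an extension applying it twice is the entrywise q^2-power. *)
Definition dag (K : finFieldType) (q m n : nat) (A : 'M[K]_(m, n)) : 'M[K]_(n, m) :=
  (map_mx (bar q) A)^T.

Lemma map_dag (K L : finFieldType) (iota : {rmorphism K -> L}) q m n
    (A : 'M[K]_(m, n)) :
  map_mx iota (dag q A) = dag q (map_mx iota A).
Proof. by apply/matrixP=> i j; rewrite !mxE /bar rmorphXn. Qed.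

Section Dag.
Variables (K : finFieldType) (q : nat) (hq : [pchar K].-nat q).

Lemma dagE m n (A : 'M[K]_(m, n)) : dag q A = (map_mx (qfrob hq) A)^T.
Proof. by []. Qed.

Lemma dagM m n p (A : 'M[K]_(m, n)) (B : 'M_(n, p)) :
  dag q (A *m B) = dag q B *m dag q A.
Proof. by rewrite !dagE map_mxM trmx_mul. Qed.

Lemma dagD m n (A B : 'M[K]_(m, n)) : dag q (A + B) = dag q A + dag q B.
Proof. by rewrite !dagE map_mxD linearD. Qed.

Lemma dagZ m n a (A : 'M[K]_(m, n)) : dag q (a *: A) = a ^+ q *: dag q A.
Proof. by rewrite !dagE map_mxZ linearZ. Qed.

Lemma dag1 n : dag q (1%:M : 'M[K]_n) = 1%:M.
Proof. by rewrite !dagE map_mx1 trmx1. Qed.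

Lemma dag_unit n (A : 'M[K]_n) : (dag q A \in unitmx) = (A \in unitmx).
Proof. by rewrite dagE unitmx_tr map_unitmx. Qed.

Lemma dag_inv n (A : 'M[K]_n) : dag q (invmx A) = invmx (dag q A).
Proof. by rewrite !dagE map_invmx trmx_inv. Qed.

Lemma dag_block m1 m2 n1 n2 (A : 'M[K]_(m1, n1)) B C (D : 'M_(m2, n2)) :
  dag q (block_mx A B C D) = block_mx (dag q A) (dag q C) (dag q B) (dag q D).
Proof. by rewrite !dagE map_block_mx tr_block_mx. Qed.

Lemma dag0 m n : dag q (0 : 'M[K]_(m, n)) = 0.
Proof. by rewrite dagE map_mx0 trmx0. Qed.

Hypothesis barK : forall x : K, (x ^+ q) ^+ q = x.

Lemma dagK m n (A : 'M[K]_(m, n)) : dag q (dag q A) = A.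
Proof. by apply/matrixP=> i j; rewrite !mxE /bar barK. Qed.

Hypothesis norm_surj : forall a : K, a != 0 -> a ^+ q = a ->
  exists b, b * b ^+ q = a.
Hypothesis trace_neq0 : exists c : K, c + c ^+ q != 0.

(** If the form vanished on all vectors, polarisation would make u H v^dagger equal to minus its
    conjugate for all u, v. Scaling a basis vector at a nonzero entry of [H] makes this value any
    chosen c, so c + c^q = 0 for every c. The argument is valid in characteristic 2. *)
Lemma exists_anisotropic n (H : 'M[K]_n) : dag q H = H -> H != 0 ->
  exists v : 'rV_n, (v *m H *m dag q v) 0 0 != 0.
Proof.
move=> hH H0; apply/existsP; apply: contraNT H0 => /existsPn allz.
have z (v : 'rV[K]_n) : v *m H *m dag q v = 0.
  by apply/matrixP=> i j; rewrite (ord1 i) (ord1 j) [RHS]mxE; apply/eqP; have:= allz v; rewrite negbK.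
have sym (u v : 'rV[K]_n) : u *m H *m dag q v = - dag q (u *m H *m dag q v).
  apply/eqP; rewrite -addr_eq0 !dagM dagK hH mulmxA.
  have := z (u + v); rewrite dagD !(mulmxDl, mulmxDr) !z add0r addr0 => <-.
  by rewrite addrC.
have [c c0] := trace_neq0.
apply/eqP/matrixP=> i j; rewrite [RHS]mxE; apply: contraNeq c0 => h0.
have := sym ((c / H i j) *: delta_mx 0 i) (delta_mx 0 j).
rewrite -!scalemxAl -rowE => /(congr1 (fun B : 'M[K]_1 => B 0 0)).
have -> : dag q (delta_mx 0 j : 'rV[K]_n) = (delta_mx j 0 : 'cV[K]_n).
  apply/matrixP=> k l; rewrite !mxE /bar andbC.
  by case: (_ && _); rewrite ?expr1n // [LHS](rmorph0 (qfrob hq)).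
rewrite -colE !mxE divfK // /bar => /eqP.
by rewrite -addr_eq0.
Qed.

Lemma unitmx_first_row n (v : 'rV[K]_n.+1) : v != 0 ->
  exists2 Q : 'M[K]_n.+1, Q \in unitmx & row 0 Q = v.
Proof.
move=> v0; have rv : \rank v = 1%N by rewrite rank_rV v0.
pose c := col_ebase v 0 0.
have c0 : c != 0.
  have := col_ebase_unit v; rewrite unitmxE [col_ebase v]mx11_scalar det_scalar1.
  by rewrite unitfE.
exists (c *: row_ebase v); first by rewrite unitmxZ ?unitfE ?row_ebase_unit.
rewrite -[in RHS](mulmx_ebase v) rv [col_ebase v]mx11_scalar -/c -mulmxA.
rewrite mul_scalar_mx linearZ /=; congr (_ *: _).
rewrite rowE; congr (_ *m _); apply/matrixP=> i j; rewrite !mxE !ord1.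
by rewrite eqxx /= andbT eq_sym.
Qed.

(** Gram-Schmidt by induction: an anisotropic vector becomes the first basis vector, is rescaled to
    norm 1 by surjectivity of the norm, and is split off. *)
Lemma hermitian_diag n (H : 'M[K]_n) : dag q H = H -> H \in unitmx ->
  exists P : 'M[K]_n, P *m H *m dag q P = 1%:M.
Proof.
elim: n H => [|n IHn] H hH uH.
  by exists 1%:M; apply/matrixP=> -[].
have H0 : H != 0.
  apply: contraTneq uH => ->; rewrite unitmxE det0 unitr0 //.
have [v vHv] := exists_anisotropic hH H0.
have [Q uQ Qv] : exists2 Q : 'M[K]_n.+1, Q \in unitmx & row 0 Q = v.
  by apply: unitmx_first_row; apply: contraNneq vHv => ->; rewrite !mul0mx mxE.
have [H1 DH1] : exists H1 : 'M[K]_(1 + n), H1 = Q *m H *m dag q Q by eexists.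
have hH1 : dag q H1 = H1 by rewrite DH1 !dagM dagK hH mulmxA.
have uH1 : H1 \in unitmx by rewrite DH1 !unitmx_mul dag_unit uQ uH.
pose a := H1 0 0.
have a0 : a != 0.
  suff -> : a = (v *m H *m dag q v) 0 0 by [].
  rewrite -Qv -row_mul /a DH1 [in RHS]mxE [in LHS]mxE.
  by apply: eq_bigr => j _; rewrite !mxE.
have aq : a ^+ q = a.
  by rewrite /a -{2}hH1 !mxE.
have [||b bb] := norm_surj (a := a^-1); rewrite ?invr_eq0 ?exprVn ?aq //.
pose r := dlsubmx H1; pose D := drsubmx H1.
have ulE : ulsubmx H1 = a%:M.
  rewrite [LHS]mx11_scalar; congr _%:M; rewrite !mxE /a.
  by congr (H1 _ _); apply: val_inj.
have H1E : H1 = block_mx a%:M (dag q r) r D.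
  rewrite -[LHS]submxK ulE; congr (block_mx _ _ _ _).
  by rewrite -[in LHS]hH1; apply/matrixP=> i j; rewrite !mxE.
(* Block elimination: with b b^q = a^-1 the corner becomes 1, the lower left block is cleared, and
   the Schur complement [D'] remains. *)
pose P1 : 'M[K]_(1 + n) := block_mx b%:M 0 (- a^-1 *: r) 1%:M.
pose D' := D - a^-1 *: (r *m dag q r).
have E1 : P1 *m H1 *m dag q P1 = block_mx 1%:M 0 0 D'.
  have ds x : dag q (x%:M : 'M[K]_1) = (x ^+ q)%:M.
    by rewrite dagE map_scalar_mx tr_scalar_mx.
  rewrite H1E /P1 dag_block !mulmx_block ds dag0 dag1 dagZ.
  rewrite !(mul0mx, mulmx0, mul1mx, mulmx1, addr0, add0r).
  rewrite exprNn_pchar // exprVn aq -!scalar_mxM.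
  have -> : - a^-1 *: r *m a%:M + r = 0.
    by rewrite -scalemxAl mul_mx_scalar scalerA mulNr mulVf // scaleN1r addNr.
  rewrite !mul0mx add0r mulrAC bb mulVf //; congr (block_mx _ _ _ _).
    rewrite -scalemxAr !mul_scalar_mx scalerA mulNr mulrCA mulVf //.
    by rewrite mulr1 scaleNr addNr.
  by rewrite addrC /D' -scalemxAl scaleNr.
have uP1 : P1 \in unitmx.
  rewrite unitmxE det_lblock det1 mulr1 det_scalar1 unitfE.
  by apply: contraNneq (invr_neq0 a0) => b0; rewrite -bb b0 mul0r.
have uD' : D' \in unitmx.
  have : P1 *m H1 *m dag q P1 \in unitmx by rewrite !unitmx_mul dag_unit uP1 uH1.
  by rewrite E1 unitmxE det_ublock det1 mul1r -unitmxE.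
have hD' : dag q D' = D'.
  have := congr1 (@dag K q _ _) E1.
  rewrite !dagM dagK hH1 mulmxA E1.
  by rewrite dag_block => /eq_block_mx[_ _ _ <-].
have [P' P'E] := IHn D' hD' uD'.
exists (block_mx 1%:M 0 0 P' *m P1 *m Q).
have -> : block_mx 1%:M 0 0 P' *m P1 *m Q *m H *m dag q (block_mx 1%:M 0 0 P' *m P1 *m Q)
  = block_mx 1%:M 0 0 P' *m (P1 *m H1 *m dag q P1) *m dag q (block_mx 1%:M 0 0 P').
  by rewrite !dagM DH1 !mulmxA.
rewrite E1 dag_block !mulmx_block dag1 !dag0.
rewrite !(mul0mx, mulmx0, mul1mx, mulmx1, addr0, add0r) P'E.
exact: esym (@scalar_mx_block _ 1 n 1).
Qed.

Lemma hermitian_congruent n (H1 H2 : 'M[K]_n) :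
    dag q H1 = H1 -> H1 \in unitmx -> dag q H2 = H2 -> H2 \in unitmx ->
  exists2 P : 'M[K]_n, P \in unitmx & P *m H1 *m dag q P = H2.
Proof.
move=> h1 u1 h2 u2; have [P1 E1] := hermitian_diag h1 u1.
have [P2 E2] := hermitian_diag h2 u2.
have uP2 : P2 \in unitmx.
  by move: E2; rewrite -mulmxA => /mulmx1_unit[].
have uP1 : P1 \in unitmx.
  by move: E1; rewrite -mulmxA => /mulmx1_unit[].
exists (invmx P2 *m P1); first by rewrite unitmx_mul unitmx_inv uP2.
transitivity (invmx P2 *m (P1 *m H1 *m dag q P1) *m invmx (dag q P2)).
  by rewrite dagM dag_inv !mulmxA.
by rewrite E1 -E2 !mulmxA mulVmx // mul1mx mulmxK ?dag_unit.
Qed.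

End Dag.

(** * Norm and trace from F to its subfield of order q *)

Section BarHermitian.
Variables (F : finFieldType) (q : nat) (hF : #|F| = (q ^ 2)%N).

Lemma barK_F (x : F) : (x ^+ q) ^+ q = x.
Proof. by rewrite -exprM mulnn -hF expf_card. Qed.

(** Here a^(q-1) = 1 and (q+1)(q-1) = |F| - 1, so [X^(q+1) - a] divides [X^|F| - X], which splits
    over [F] itself. *)
Lemma norm_surj_F (a : F) : a != 0 -> a ^+ q = a -> exists b, b * b ^+ q = a.
Proof.
move=> a0 aq; have q1 := q_gt1 hF.
have [b Db] : exists b, b ^+ (q + 1) = a.
  apply: (@splits_unity_root _ _ (q - 1)); rewrite ?addn1 //; last first.
    by apply: (mulfI a0); rewrite -exprS subn1 prednK ?mulr1 // ltnW.
  have spl : splits ('X^#|F| - 'X : {poly F}).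
    by exists (enum F); rewrite finField_genPoly big_enum eqpxx.
  apply: splits_dvd spl _.
  have -> : 'X^#|F| - 'X = 'X * ('X^(q.+1 * (q - 1)) - 1) :> {poly F}.
    rewrite mulrBr mulr1 -exprS hF; congr ('X^_ - _).
    by rewrite -mulnn; clear -q1; nia.
  exact: dvdp_mull.
by exists b; rewrite -exprS -addn1.
Qed.

(** Otherwise [X^q + X] would have q^2 roots, more than its degree. *)
Lemma trace_neq0_F : exists c : F, c + c ^+ q != 0.
Proof.
apply/existsP; apply: contraT => /existsPn allz.
have q1 := q_gt1 hF.
have szp : size ('X^q + 'X : {poly F}) = q.+1.
  by rewrite size_polyDl size_polyXn // size_polyX.
have p0 : 'X^q + 'X != 0 :> {poly F} by rewrite -size_poly_eq0 szp.
have rts : all (root ('X^q + 'X : {poly F})) (enum F).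
  by apply/allP=> x _; rewrite /root !hornerE addrC; have:= allz x; rewrite negbK.
have := max_poly_roots p0 rts (enum_uniq F); rewrite szp -cardE hF ltnS -mulnn.
by clear -q1; nia.
Qed.
End BarHermitian.

(** * The twisted Frobenius and unitary matrices over an extension *)

(** Since the inverse of 0 is 0, sigma is a total injection on [L] with 0 as a fixed point, which
    must be excluded separately from eigenvalue sets. *)
Definition sigma (L : finFieldType) (q : nat) (x : L) : L := (x ^+ q)^-1.

Definition torus_order (q m : nat) : nat :=
  if odd m then (q ^ m + 1)%N else (q ^ m - 1)%N.

Section Sigma.
Variables (L : finFieldType) (q : nat) (hq : [pchar L].-nat q).
Local Notation sg := (@sigma L q).

Lemma qpow_inj : injective (fun x : L => x ^+ q).
Proof. exact: (fmorph_inj (qfrob hq)). Qed.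

Lemma sigma_inj : injective sg.
Proof. by move=> x y /invr_inj /qpow_inj. Qed.

Lemma sigma_eq0 x : (sg x == 0) = (x == 0).
Proof. by rewrite invr_eq0 (fmorph_eq0 (qfrob hq)). Qed.

Lemma sigmaX M : {morph sg : x / x ^+ M}.
Proof. by move=> x; rewrite /sigma exprVn -!exprM mulnC. Qed.

Lemma iter_sigma k x :
  iter k sg x = if odd k then (x ^+ (q ^ k))^-1 else x ^+ (q ^ k).
Proof.
elim: k => [|k IH]; first by rewrite /= expn0 expr1.
rewrite iterS IH /sigma expnSr /=; case: (odd k) => /=.
  by rewrite exprVn invrK exprM.
by rewrite exprM.
Qed.

Lemma iter_sigmaX k M x : iter k sg (x ^+ M) = iter k sg x ^+ M.
Proof. by elim: k => //= k ->; rewrite sigmaX. Qed.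

Lemma sigma2 x : sg (sg x) = x ^+ (q ^ 2).
Proof. by rewrite -[LHS]/(iter 2 sg x) iter_sigma. Qed.

Lemma iter_sigma_eq0 k x : (iter k sg x == 0) = (x == 0).
Proof. by elim: k => //= k; rewrite sigma_eq0. Qed.

Variable n : nat.
Hypotheses (q1 : (1 < q)%N) (q0 : q%:R = 0 :> L).
Hypothesis splU : forall d, (0 < d <= n)%N ->
  splits ('X^(q ^ (2 * d) - 1) - 1 : {poly L}).

(** The fixed points are the roots of unity of order [torus_order q m]. They all lie in [L] because
    q^(2m) - 1 = (q^m + 1)(q^m - 1) for odd m, while for even m the exponent is already q^(2d) - 1
    with d = m/2; hence the two bounds. They are distinct because the order is 1 or -1 in [L]. *)
Lemma card_fixed_iter_sigma m : (0 < m)%N -> (m <= (if odd m then n else 2 * n))%N ->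
  #|[set y in [set~ 0] | iter m sg y == y]| = torus_order q m.
Proof.
move=> m0 lem; have qm1 : (0 < q ^ m)%N by rewrite expn_gt0 ltnW.
have qm0 : (q ^ m)%:R = 0 :> L by rewrite natrX q0 expr0n gtn_eqF.
have key : exists l, splits ('X^(torus_order q m * l) - 1 : {poly L}).
  rewrite /torus_order; case: (boolP (odd m)) lem => om lem.
    exists (q ^ m - 1)%N; have := splU (d := m); rewrite m0 => /(_ lem).
    rewrite mulnC expnM -mulnn; suff -> : (q ^ m * q ^ m - 1 = (q ^ m + 1) * (q ^ m - 1))%N by [].
    by clear -qm1; nia.
  exists 1%N; have [e em] : exists e, m = (2 * e)%N by exists m./2; lia.
  by rewrite muln1 em; apply: splU; lia.
have k0 : (torus_order q m)%:R != 0 :> L.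
  rewrite /torus_order; case: ifP => _.
    by rewrite natrD qm0 add0r oner_neq0.
  by rewrite natrB // qm0 sub0r oppr_eq0 oner_neq0.
have [l spl] := key; rewrite -[RHS](splits_card_unity spl k0).
apply: eq_card => y; rewrite !inE iter_sigma /torus_order.
have [->|y0] /= := eqVneq y 0.
  rewrite expr0n; case: ifP => om; first by rewrite addn1 /= eq_sym oner_eq0.
  have : (1 < q ^ m)%N by rewrite -(exp1n m) ltn_exp2r.
  by case: (q ^ m)%N => [|[|k]] // _; rewrite subn1 eq_sym oner_eq0.
case: ifP => _.
  by rewrite -(inj_eq (mulfI (expf_neq0 (q ^ m) y0))) mulfV ?expf_neq0 // exprD expr1 eq_sym.
by rewrite -[RHS](inj_eq (mulIf y0)) mul1r -exprSr subn1 prednK.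
Qed.

(** This is surjectivity of the norm from the field of order q^(2m) to the field of order q^m. *)
Lemma odd_norm_surj m c : odd m -> (m <= n)%N -> c ^+ (q ^ m) = c -> c != 0 ->
  exists2 a : L, a != 0 & a ^+ (q ^ m).+1 = c.
Proof.
move=> om lem cq c0; have m0 : (0 < m)%N by case: m om {lem cq}.
have qm1 : (0 < q ^ m)%N by rewrite expn_gt0 ltnW.
have [|||a Da] := @splits_unity_root L (q ^ m).+1 (q ^ m - 1) c; rewrite ?m0 //.
- have := splU (d := m); rewrite m0 => /(_ lem).
  rewrite mulnC expnM -mulnn; suff -> : (q ^ m * q ^ m - 1 = (q ^ m).+1 * (q ^ m - 1))%N by [].
  by clear -qm1; nia.
- by apply: (mulfI c0); rewrite -exprS subn1 prednK ?mulr1.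
by exists a => //; apply: contraNneq c0 => a0; rewrite -Da a0 expr0n.
Qed.
End Sigma.

(** * Descent from L to F *)

Section Descent.
Variables (F L : finFieldType) (iota : {rmorphism F -> L}) (q : nat).
Hypothesis hF : #|F| = (q ^ 2)%N.

(** Over [F] the polynomial [X^(q^2) - X] is the product of all [X - a]; mapped to [L], it has no
    roots beyond the images of these a. *)
Lemma fixed_descent (x : L) : x ^+ (q ^ 2) = x -> exists a, x = iota a.
Proof.
move=> xq; have := congr1 (map_poly iota) (finField_genPoly F).
rewrite rmorphB rmorph_prod /= map_polyXn map_polyX hF => E.
have : root (\prod_a map_poly iota ('X - a%:P)) x.
  by rewrite -E /root !hornerE xq subrr.
rewrite /root horner_prod prodf_seq_eq0 => /hasP[a _ /=].
rewrite rmorphB /= map_polyX map_polyC !hornerE subr_eq0 => /eqP.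
by exists a.
Qed.

Lemma poly_descent (p : {poly L}) :
  (forall i, p`_i ^+ (q ^ 2) = p`_i) -> exists f, p = map_poly iota f.
Proof.
move=> pq; have /choice [g Dg] i := fixed_descent (pq i).
exists (\poly_(i < size p) g i); apply/polyP=> i.
rewrite coef_map coef_poly; case: ltnP => [_|ge]; first exact: Dg.
by rewrite raddf0 nth_default.
Qed.

Lemma mx_descent m n (A : 'M[L]_(m, n)) : dag q (dag q A) = A ->
  exists A', A = map_mx iota A'.
Proof.
move=> Aq; have Aq' i j : A i j ^+ (q ^ 2) = A i j.
  by rewrite -{2}Aq !mxE /bar -exprM mulnn.
have /choice [g Dg] : forall u : 'I_m * 'I_n, exists a, A u.1 u.2 = iota a.
  by move=> [i j]; apply: fixed_descent.
exists (\matrix_(i, j) g (i, j)); apply/matrixP=> i j; rewrite !mxE.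
exact: (Dg (i, j)).
Qed.
End Descent.

Section Antidiag.
Variables (L : finFieldType) (q n : nat) (hq : [pchar L].-nat q).
Local Notation J := (antidiag L n).

Lemma antidiag_perm : J = perm_mx (perm (@rev_ord_inj n)).
Proof.
apply/matrixP=> i j; rewrite !mxE permE; congr (_%:R); congr nat_of_bool.
by rewrite -val_eqE /=; have := ltn_ord i; have := ltn_ord j; clear; lia.
Qed.

Lemma antidiag_unit : J \in unitmx.
Proof. by rewrite antidiag_perm unitmx_perm. Qed.

Lemma dag_perm_mx (s : 'S_n) : dag q (perm_mx s : 'M[L]_n) = perm_mx (s^-1)%g.
Proof.
rewrite -tr_perm_mx dagE; congr _^T; apply: (map_perm_mx (qfrob hq)).
Qed.

Lemma dag_antidiag : dag q J = J.
Proof.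
rewrite antidiag_perm dag_perm_mx; congr perm_mx.
apply/perm.permP=> i; apply: (perm_inj (s := perm (@rev_ord_inj n))).
by rewrite permKV !permE rev_ordK.
Qed.

Lemma UgroupP (A : 'M[L]_n) :
  reflect (A *m J *m dag q A = J) (A \in Ugroup L q n).
Proof.
rewrite inE; apply: (iffP andP) => [[_ /eqP]//|E]; split; last exact/eqP.
by have := antidiag_unit; rewrite -E !unitmx_mul => /andP[/andP[]].
Qed.

Lemma Ugroup_unit (A : 'M[L]_n) : A \in Ugroup L q n -> A \in unitmx.
Proof. by rewrite inE => /andP[]. Qed.

(** The dagger of A J A^dagger = J reads A^dagger^dagger J A^dagger = J; comparing the two equations
    and cancelling J A^dagger gives the claim. It confines unitary matrices over [L] to [F]. *)
Lemma Ugroup_dagK (A : 'M[L]_n) : A \in Ugroup L q n -> dag q (dag q A) = A.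
Proof.
move=> UA; have /UgroupP E := UA; have uA := Ugroup_unit UA.
have u : J *m dag q A \in unitmx by rewrite unitmx_mul antidiag_unit dag_unit.
apply: (can_inj (mulmxK u)); rewrite !mulmxA E -[RHS]dag_antidiag -[in RHS]E.
by rewrite !dagM // dag_antidiag mulmxA.
Qed.

End Antidiag.

Section UgroupDescent.
Variables (F L : finFieldType) (iota : {rmorphism F -> L}) (q n : nat).
Hypothesis hF : #|F| = (q ^ 2)%N.
Let hq := q_pchar_ext hF iota.

Lemma map_antidiag : map_mx iota (antidiag F n) = antidiag L n.
Proof. by apply/matrixP=> i j; rewrite !mxE rmorph_nat. Qed.

Lemma map_unitaryb (A : 'M[F]_n) : unitaryb q (map_mx iota A) = unitaryb q A.
Proof.
rewrite /unitaryb map_unitmx -map_antidiag; congr andb.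
rewrite -[(map_mx (bar q) (map_mx _ _))^T]map_dag -!map_mxM.
by rewrite (inj_eq (@map_mx_inj _ _ iota n n)).
Qed.

Lemma unitary_descent (A : 'M[L]_n) : unitaryb q A -> exists A', A = map_mx iota A'.
Proof.
rewrite -[unitaryb q A](in_set (@unitaryb L q n)) => /(Ugroup_dagK hq).
exact: mx_descent.
Qed.

Lemma card_Ugroup_ext : #|Ugroup L q n| = #|Ugroup F q n|.
Proof.
have inj := @map_mx_inj _ _ iota n n.
rewrite -(card_imset _ inj); apply: eq_card => A; apply/idP/imsetP.
  rewrite inE => UA; have [A' DA] := unitary_descent UA.
  by exists A'; rewrite // inE -map_unitaryb -DA.
by case=> A'; rewrite !inE => UA ->; rewrite map_unitaryb.
Qed.

Lemma map_mxX m (A : 'M[F]_m) k : map_mx iota (A ^+ k) = map_mx iota A ^+ k.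
Proof.
elim: k => [|k IH]; first by rewrite !expr0 [LHS]map_mx1.
by rewrite !exprS -IH; apply: map_mxM.
Qed.

(** The M-th root is itself unitary, so it descends to [F] together with the matrix. *)
Lemma S_U_ext M : S_U L q M n = S_U F q M n.
Proof.
have inj := @map_mx_inj _ _ iota n n.
rewrite /S_U -[RHS](card_imset _ inj); apply: eq_card => A; apply/idP/imsetP.
  rewrite inE => /and3P[UA sepA /existsP[a /andP[Ua /eqP Da]]].
  have [A' DA] := unitary_descent UA; have [a' Da'] := unitary_descent Ua.
  exists A' => //; rewrite inE -map_unitaryb -DA UA.
  move: sepA; rewrite /separable_mx DA -map_char_poly separable_map => ->.
  apply/existsP; exists a'; rewrite -map_unitaryb -Da' Ua.
  by apply/eqP/inj; rewrite map_mxX -Da' Da DA.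
case=> A'; rewrite !inE => /and3P[UA sepA /existsP[a /andP[Ua /eqP Da]]] ->.
rewrite map_unitaryb UA /separable_mx -map_char_poly separable_map.
rewrite -/(separable_mx A') sepA /=.
apply/existsP; exists (map_mx iota a); rewrite map_unitaryb Ua.
by rewrite -map_mxX Da eqxx.
Qed.
End UgroupDescent.

(** * Eigenbases *)

Section Eigenbasis.
Variables (K : fieldType) (n : nat) (A : 'M[K]_n) (z : 'I_n -> K).
Hypothesis injz : injective z.

Section Basis.
Variable W : 'M[K]_n.
Hypotheses (eigW : forall i, row i W *m A = z i *: row i W)
  (W0 : forall i, row i W != 0).

Lemma rank_eigenspace_gt0 k : (1 <= \rank (eigenspace A (z k)))%N.
Proof.
apply: leq_trans (_ : \rank (row k W) <= _)%N; first by rewrite rank_rV W0.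
by apply: mxrankS; apply/eigenspaceP.
Qed.

Lemma rank_sum_eigenspaces :
  (\rank (\sum_k eigenspace A (z k))%MS = \sum_k \rank (eigenspace A (z k)))%N.
Proof.
have dir : mxdirect (\sum_k eigenspace A (z k)).
  by apply: mxdirect_sum_eigenspace => ? ? _ _ /injz.
exact: mxdirectP dir.
Qed.

(** The n eigenspaces are independent and nonzero in dimension n, so each is a line. *)
Lemma eigenspace_rows i : (eigenspace A (z i) <= row i W)%MS.
Proof.
have sub k : (row k W <= eigenspace A (z k))%MS by apply/eigenspaceP.
have := leqif_sum (fun k (_ : true) => leqif_eq (rank_eigenspace_gt0 k)).
rewrite sum1_card card_ord => -[le /esym]; rewrite eqn_leq le /= -rank_sum_eigenspaces.
rewrite rank_leq_row => /forallP/(_ i)/= /eqP ri.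
rewrite -(mxrank_leqif_sup (sub i)) rank_rV W0; exact/eqP.
Qed.

Lemma eigenrow_colinear i (x : 'rV_n) : x *m A = z i *: x ->
  exists c, x = c *: row i W.
Proof.
move=> xA; apply/sub_rVP; apply: submx_trans (eigenspace_rows i).
exact/eigenspaceP.
Qed.

Lemma eigenbasis_unit : W \in unitmx.
Proof.
rewrite -row_full_unit /row_full eqn_leq rank_leq_row.
apply: leq_trans (_ : \rank (\sum_k eigenspace A (z k))%MS <= _)%N.
  rewrite rank_sum_eigenspaces -[X in (X <= _)%N]card_ord -sum1_card.
  by apply: leq_sum => k _; apply: rank_eigenspace_gt0.
apply: mxrankS; apply/sumsmx_subP => k _.
by apply: submx_trans (eigenspace_rows k) (row_sub _ _).
Qed.
End Basis.

Lemma char_poly_eigenvalues : (forall i, root (char_poly A) (z i)) ->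
  char_poly A = \prod_i ('X - (z i)%:P).
Proof.
move=> rz; have := all_roots_prod_XsubC (p := char_poly A) (rs := codom z).
rewrite size_char_poly size_codom card_ord => /(_ erefl).
have -> : all (root (char_poly A)) (codom z).
  by apply/allP=> x /codomP[i ->].
rewrite uniq_rootsE; have -> : uniq (codom z) by apply/injectiveP.
move=> /(_ isT isT) {1}->; rewrite (monicP (char_poly_monic A)) scale1r.
by rewrite big_image.
Qed.

(** Distinct eigenvalues force the centraliser of [A] to be diagonal in its eigenbasis. This gives
    both the uniqueness of W up to the torus and the shape of M-th roots. *)
Lemma diagonal_of_commute (B W : 'M[K]_n) :
    W \in unitmx -> W *m A = diag_mx (\row_i z i) *m W -> A *m B = B *m A ->
  exists t : 'rV_n, W *m B = diag_mx t *m W.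
Proof.
move=> uW WA AB; have [C DC] : exists C, C = W *m B *m invmx W by eexists.
have CD : C *m diag_mx (\row_i z i) = diag_mx (\row_i z i) *m C.
  have -> : diag_mx (\row_i z i) = W *m A *m invmx W by rewrite WA mulmxK.
  by rewrite DC !mulmxA !mulmxKV // -!(mulmxA W) AB.
have Cd i j : i != j -> C i j = 0.
  move/matrixP: CD => /(_ i j); rewrite mul_mx_diag mul_diag_mx !mxE => /eqP.
  rewrite mulrC -subr_eq0 -mulrBl mulf_eq0 subr_eq0 (inj_eq injz) eq_sym.
  by case: eqP => //= _ /eqP.
exists (\row_i C i i); have -> : diag_mx (\row_i C i i) = C.
  apply/matrixP=> i j; rewrite !mxE; case: eqVneq => [->|/Cd ->]; first by rewrite mulr1n.
  by rewrite mulr0n.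
by rewrite DC mulmxKV.
Qed.
End Eigenbasis.

Lemma char_poly_tr (R : comNzRingType) n (A : 'M[R]_n) : char_poly A^T = char_poly A.
Proof.
rewrite /char_poly -[RHS]det_tr; congr (\det _).
by apply/matrixP=> i j; rewrite !mxE eq_sym.
Qed.

Lemma diag_dag_entry (K : finFieldType) q (hq : [pchar K].-nat q) m n
    (t : 'rV[K]_m) (G : 'M_(m, n)) (u : 'rV_n) i j :
  (diag_mx t *m G *m dag q (diag_mx u)) i j = t 0 i * G i j * (u 0 j) ^+ q.
Proof.
rewrite (dagE hq) map_diag_mx tr_diag_mx mul_mx_diag mxE mul_diag_mx.
by rewrite !mxE.
Qed.

Lemma diag_mx_inj (R : pzSemiRingType) n : injective (@diag_mx R n).
Proof.
move=> t u /matrixP E; apply/rowP=> j.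
by have := E j j; rewrite !mxE eqxx !mulr1n.
Qed.

(** * Counting the unitary matrices with given eigenvalues *)

Section Omega.
Variables (F L : finFieldType) (iota : {rmorphism F -> L}) (q n : nat).
Hypothesis hF : #|F| = (q ^ 2)%N.
Hypothesis splU : forall d, (0 < d <= n)%N ->
  splits ('X^(q ^ (2 * d) - 1) - 1 : {poly L}).
Let hq : [pchar L].-nat q := q_pchar_ext hF iota.
Let q1 : (1 < q)%N := q_gt1 hF.
Local Notation sg := (@sigma L q).
Local Notation J := (antidiag L n).
Variables (z : 'I_n -> L) (s : 'I_n -> 'I_n).
Hypotheses (injz : injective z) (z0 : forall i, z i != 0)
  (zs : forall i, z (s i) = sg (z i)).

Lemma index_perm_inj : injective s.
Proof. by move=> i j sij; apply/injz/(sigma_inj hq); rewrite -!zs sij. Qed.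
Let sp := perm index_perm_inj.

(** Preserving the form lets eigenvectors i and j pair nontrivially only if z_i z_j^q = 1, that is,
    i = s j. The inverse permutation is due to the convention of [perm_mx]: the ones sit at the
    entries (s j, j). *)
Definition twist_mx : 'M[L]_n := perm_mx (sp^-1)%g.
Local Notation S := twist_mx.
Local Notation D := (diag_mx (\row_i z i)).

Lemma twist_mxE i j : S i j = (i == s j)%:R.
Proof.
rewrite !mxE -(inj_eq (perm_inj (s := sp))) permKV permE.
by rewrite eq_sym.
Qed.

Lemma dag_twist : dag q S = perm_mx sp.
Proof. by rewrite dag_perm_mx // invgK. Qed.

Lemma twist_unit : S \in unitmx. Proof. exact: unitmx_perm. Qed.

Lemma twist_torus (t : 'rV[L]_n) :
  diag_mx t *m S *m dag q (diag_mx t) = S ->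
  forall j, t 0 j != 0 /\ t 0 (s j) = sg (t 0 j).
Proof.
move=> /matrixP E j; have := E (s j) j.
rewrite diag_dag_entry // twist_mxE eqxx mulr1 => e.
have t0 : t 0 j ^+ q != 0.
  by apply: contra_eq_neq e => ->; rewrite mulr0 eq_sym oner_eq0.
split; first by apply: contraNneq t0 => ->; rewrite expr0n gtn_eqF // ltnW.
by apply: (mulIf t0); rewrite e /sigma mulVf.
Qed.

Lemma torus_twist (t : 'rV[L]_n) :
  (forall j, t 0 j != 0) -> (forall j, t 0 (s j) = sg (t 0 j)) ->
  diag_mx t *m S *m dag q (diag_mx t) = S.
Proof.
move=> t0 ts; apply/matrixP=> i j; rewrite diag_dag_entry // twist_mxE.
have [->|_] := eqVneq i (s j); last by rewrite mulr0 mul0r.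
by rewrite ts mulr1 /sigma mulVf // expf_neq0.
Qed.

Definition Omega : {set 'M[L]_n} := [set W | W *m J *m dag q W == S].

Lemma OmegaP W : reflect (W *m J *m dag q W = S) (W \in Omega).
Proof. by rewrite inE; apply: eqP. Qed.

Lemma Omega_unit W : W \in Omega -> W \in unitmx.
Proof.
by move/OmegaP=> E; have := twist_unit; rewrite -E !unitmx_mul => /andP[/andP[]].
Qed.

(* A Vandermonde matrix on the eigenvalues turns the twist into a Hermitian
   matrix with entries in F. *)
Lemma Omega_nonempty : exists W, W \in Omega.
Proof.
pose V : 'M[L]_n := \matrix_(i, j) z i ^+ j.
have uV : V \in unitmx.
  have -> : V = (Vandermonde n (\row_i z i))^T by apply/matrixP=> i j; rewrite !mxE.
  rewrite unitmx_tr unitmxE det_Vandermonde unitfE.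
  apply/prodf_neq0 => i _; apply/prodf_neq0 => j ltij; rewrite !mxE subr_eq0.
  by apply: contraTneq ltij => /injz ->; rewrite ltnn.
(* The square of sigma is the q^2-power, so Frobenius only permutes the rows of the Vandermonde
   matrix. *)
have VV : dag q (dag q V) = perm_mx (sp * sp)%g *m V.
  rewrite -row_permE; apply/matrixP=> i j; rewrite !mxE permM !permE !zs /bar.
  by rewrite sigma2 -!exprM mulnn mulnC.
pose H := invmx V *m S *m invmx (dag q V).
have hH : dag q H = H.
  rewrite /H !dagM // !dag_inv // dag_twist VV -[in RHS]mulmxA.
  rewrite (_ : invmx (perm_mx (sp * sp)%g *m V) = invmx V *m S *m S).
    by rewrite -!mulmxA (mulmxA S (perm_mx sp)) -perm_mxM mulVg perm_mx1 mul1mx.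
  apply: (can_inj (mulKmx (_ : perm_mx (sp * sp)%g *m V \in unitmx))).
    by rewrite unitmx_mul unitmx_perm.
  rewrite mulmxV ?unitmx_mul ?unitmx_perm // !mulmxA mulmxK //.
  by rewrite -!perm_mxM mulgK mulgV perm_mx1.
have [H' DH] : exists H', H = map_mx iota H' by apply: (mx_descent iota hF); rewrite !hH.
have uH : H \in unitmx by rewrite !unitmx_mul !unitmx_inv uV twist_unit dag_unit.
(* Over [F] the forms J and [H'] are congruent through some [P]. Then V P is the required matrix,
   since V H V^dagger = S by the choice of [H]. *)
have [||||P uP DP] := @hermitian_congruent F q (q_pchar hF) (barK_F hF)
    (norm_surj_F hF) (trace_neq0_F hF) n (antidiag F n) H'.
- by rewrite (dag_antidiag n (q_pchar hF)).
- by apply: antidiag_unit.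
- by apply: (@map_mx_inj _ _ iota); rewrite map_dag -DH.
- by rewrite -(map_unitmx iota) -DH.
exists (V *m map_mx iota P); apply/OmegaP.
have DP' : map_mx iota P *m J *m dag q (map_mx iota P) = H.
  by rewrite -(map_antidiag iota) -map_dag -!map_mxM DP -DH.
transitivity (V *m (map_mx iota P *m J *m dag q (map_mx iota P)) *m dag q V).
  by rewrite dagM // !mulmxA.
by rewrite DP' /H !mulmxA mulmxV // mul1mx mulmxKV // dag_unit.
Qed.

Lemma card_Omega : #|Omega| = #|Ugroup L q n|.
Proof.
have [W1 OW1] := Omega_nonempty; have uW1 := Omega_unit OW1.
rewrite -[RHS](card_imset _ (can_inj (mulKmx uW1))); apply: eq_card => W.
move/OmegaP: OW1 => E1; apply/OmegaP/imsetP => [E | [A /UgroupP UA ->]].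
  exists (invmx W1 *m W); last by rewrite mulKVmx.
  apply/UgroupP; rewrite dagM // dag_inv // -!mulmxA (mulmxA J) (mulmxA W).
  rewrite (mulmxA W) E -E1 !mulmxA mulVmx // mul1mx mulmxK ?dag_unit //.
by rewrite dagM // -!mulmxA (mulmxA A) (mulmxA (A *m J)) UA mulmxA E1.
Qed.

Definition conj_diag (W : 'M[L]_n) : 'M[L]_n := invmx W *m D *m W.

(** Change of basis by [W] carries the form J to S, so being unitary becomes a condition on the
    diagonal matrix alone. *)
Lemma Omega_conj_torus W t : W \in Omega ->
  (invmx W *m diag_mx t *m W \in Ugroup L q n) <->
  diag_mx t *m S *m dag q (diag_mx t) = S.
Proof.
move=> OW; have uW := Omega_unit OW; move/OmegaP: OW => E.
have key : W *m (invmx W *m diag_mx t *m W *m J *m dag q (invmx W *m diag_mx t *m W)) *m dag q W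
  = diag_mx t *m S *m dag q (diag_mx t).
  rewrite !dagM // dag_inv // -E !mulmxA mulmxV // mul1mx -!mulmxA mulVmx ?dag_unit //.
  by rewrite mulmx1.
split=> [/UgroupP UA | Et]; first by rewrite -key UA E.
apply/UgroupP; move: key; rewrite Et -E.
by move/(can_inj (mulmxK (etrans (dag_unit hq W) uW)))/(can_inj (mulKmx uW)).
Qed.

Definition unitary_class : {set 'M[L]_n} :=
  [set A in Ugroup L q n | char_poly A == \prod_i ('X - (z i)%:P)].

(** The eigenvalue tuple is itself a point of the torus, [zs] being exactly the torus equation. *)
Lemma Omega_class W : W \in Omega -> conj_diag W \in unitary_class.
Proof.
move=> OW; have uW := Omega_unit OW; rewrite inE; apply/andP; split.
  by apply/(Omega_conj_torus _ OW)/torus_twist => j; rewrite !mxE.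
apply/eqP/char_poly_eigenvalues => // i; rewrite -eigenvalue_root_char.
apply/eigenvalueP; exists (row i W).
  by rewrite -row_mul /conj_diag !mulmxA mulmxV // mul1mx row_mul row_diag_mx mxE -scalemxAl -rowE.
apply: contraTneq uW => Wi0; rewrite unitmxE (_ : \det W = 0) ?unitr0 //.
by rewrite (expand_det_row _ i) big1 // => j _; move/rowP: Wi0 => /(_ j); rewrite !mxE => ->; rewrite mul0r.
Qed.

(** It depends only on which entries vanish, hence is unchanged by scaling and by Frobenius. *)
Definition pivot (v : 'rV[L]_n) := [pick k | v 0 k != 0].

Lemma pivotZ c v : c != 0 -> pivot (c *: v) = pivot v.
Proof. by move=> c0; apply: eq_pick => k; rewrite mxE mulf_eq0 (negPf c0). Qed.

Lemma pivot_dag2 v : pivot (dag q (dag q v)) = pivot v.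
Proof. by apply: eq_pick => k; rewrite !mxE /bar !(fmorph_eq0 (qfrob hq)). Qed.

(* Scaling eigenvectors so that their first nonzero entry is 1 makes the choice
   of eigenvectors commute with the q^2-Frobenius. *)
Lemma normalized_eigenbasis A : A \in unitary_class ->
  exists W, [/\ forall i, row i W *m A = z i *: row i W,
                forall i, row i W != 0 &
                dag q (dag q W) = perm_mx (sp * sp)%g *m W].
Proof.
rewrite inE => /andP[UA /eqP chA].
have ex i : exists v : 'rV[L]_n, v *m A = z i *: v /\
    exists2 k, pivot v = Some k & v 0 k = 1.
  have : eigenvalue A (z i).
    rewrite eigenvalue_root_char chA /root horner_prod (bigD1 i) //=.
    by rewrite !hornerE subrr mul0r.
  case/eigenvalueP=> v vA v0.
  have [k Dk] : exists k, pivot v = Some k.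
    rewrite /pivot; case: pickP => [k _|all0]; first by exists k.
    by case/eqP: v0; apply/rowP=> k; rewrite [RHS]mxE; apply/eqP; have:= all0 k; case: eqP.
  have vk : v 0 k != 0 by move: Dk; rewrite /pivot; case: pickP => // l vl [<-].
  exists ((v 0 k)^-1 *: v); split.
    by rewrite -scalemxAl vA !scalerA mulrC.
  by exists k; rewrite ?pivotZ ?invr_eq0 // mxE mulVf.
have [w ww] := fin_all_exists ex.
have rW i : row i (\matrix_i w i) = w i by rewrite rowK.
have eigW i : row i (\matrix_i w i) *m A = z i *: row i (\matrix_i w i).
  by rewrite rW; case: (ww i).
have W0 i : row i (\matrix_i w i) != 0.
  rewrite rW; case: (ww i) => _ [k _ wk].
  by apply: contra_eq_neq wk => ->; rewrite mxE eq_sym oner_eq0.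
exists (\matrix_i w i); split=> //; rewrite -row_permE; apply/row_matrixP => i.
have -> : row i (dag q (dag q (\matrix_i w i))) = dag q (dag q (w i)).
  by apply/rowP=> j; rewrite !mxE.
have -> : row i (row_perm (sp * sp)%g (\matrix_i w i)) = w (s (s i)).
  by apply/rowP=> j; rewrite !mxE permM !permE.
have [wA [k piv wk]] := ww i.
(* [A] is fixed by the q^2-power, so the twisted eigenvector is an eigenvector for z (s (s i)),
   hence a multiple of [w (s (s i))]. Both have entry 1 at the same pivot, so the factor is 1. *)
have : dag q (dag q (w i)) *m A = z (s (s i)) *: dag q (dag q (w i)).
  rewrite -{1}(Ugroup_dagK hq UA) -!dagM // wA !dagZ //.
  by rewrite !zs sigma2 -exprM mulnn.
case/(eigenrow_colinear injz eigW W0) => c; rewrite rW => E.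
have xk : (dag q (dag q (w i))) 0 k = 1 by rewrite !mxE /bar wk !expr1n.
have c0 : c != 0.
  by apply: contra_eq_neq xk => c0; rewrite E c0 scale0r mxE eq_sym oner_eq0.
have := pivot_dag2 (w i); rewrite E pivotZ // piv.
have [_ [k' -> wk']] := ww (s (s i)) => -[kk'].
by move: xk; rewrite E mxE -kk' wk' mulr1 => ->; rewrite scale1r.
Qed.

(* The obstruction to closing up the recursion along a cycle of length m is
   a norm equation from F_{q^2m} to F_{q^m} when m is odd, and void when m is even. *)
Lemma torus_rescaling (g : 'I_n -> L) :
    (forall j, g j != 0) -> (forall j, g (s j) = g j ^+ q) ->
  exists t : 'I_n -> L, (forall j, t j != 0) /\ (forall j, t (s j) * g j * t j ^+ q = 1).
Proof.
move=> g0 gs; pose step j y := (g j * y ^+ q)^-1.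
have gk k j : g (iter k s j) = g j ^+ (q ^ k).
  by elim: k => [|k IH]; rewrite ?expn0 ?expr1 //= gs IH expnSr exprM.
(* By [gs], the factors of [g] in two consecutive steps cancel, leaving y -> y^(q^2); only an odd
   number of steps retains one factor. *)
have stepk k r y : iter k (fun u => (s u.1, step u.1 u.2)) (r, y) =
    (iter k s r, if odd k then (g r ^+ (q ^ k.-1) * y ^+ (q ^ k))^-1 else y ^+ (q ^ k)).
  elim: k => [|k IH]; first by rewrite /= expn0 expr1.
  rewrite iterS IH /=; congr pair; rewrite /step gk.
  case: (boolP (odd k)) => /= ok; last by rewrite expnSr !exprM.
  case: k ok {IH} => // k _; rewrite /= exprVn exprMn -!exprM -!expnSr.
  by rewrite invfM invrK mulrA mulVf ?mul1r // expf_neq0.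
have ex r : exists a : L, a != 0 /\
    (if odd (fingraph.order s r) then (g r ^+ (q ^ (fingraph.order s r).-1) * a ^+ (q ^ fingraph.order s r))^-1
     else a ^+ (q ^ fingraph.order s r)) = a.
  case: (boolP (odd _)) => om; last by exists 1; rewrite oner_neq0 expr1n.
  have m0 := fingraph.order_gt0 s r; pose m := fingraph.order s r; rewrite -/m in om m0 *.
  (* On an odd cycle closing up means a^(q^m + 1) = g(r)^(-q^(m-1)). The right side is fixed by the
     q^m-power because [g] returns to its value after m steps, so the norm equation is solvable. *)
  have gm : g r ^+ (q ^ m) = g r by rewrite -gk /m iter_order //; apply: index_perm_inj.
  have mn : (m <= n)%N by rewrite -[X in (_ <= X)%N]card_ord max_card.
  have c0 : (g r ^+ (q ^ m.-1))^-1 != 0 by rewrite invr_eq0 expf_neq0.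
  have [|a a0 Da] := odd_norm_surj q1 splU om mn _ c0.
    by rewrite exprVn -!exprM mulnC exprM gm.
  exists a; split=> //; apply: (mulIf (expf_neq0 (q ^ m) a0)).
  by rewrite invfM -mulrA mulVf ?expf_neq0 // mulr1 -exprS Da.
have [a aP] := fin_all_exists ex.
have [|t [ta ts]] := equivariant_section index_perm_inj (step := step) (a := a).
  by move=> r _; rewrite stepk iter_order ?(aP r).2 //; apply: index_perm_inj.
have t0 j : t j != 0.
  rewrite -(iter_froot index_perm_inj j); elim: (findex s _ j) => [|k IH] /=.
    rewrite ta; first by case: (aP (froot s j)).
    by apply: root_root; apply: fconnect_sym; apply: index_perm_inj.
  by rewrite ts invr_eq0 mulf_neq0 ?expf_neq0.
exists t; split=> // j; rewrite ts /step -mulrA mulVf // mulf_neq0 ?expf_neq0 //.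
Qed.

(** In the normalised eigenbasis the Gram matrix [G] of J has the same support as S, so only a
    diagonal rescaling is needed to turn its nonzero entries into ones. *)
Lemma conj_diag_surj A : A \in unitary_class ->
  exists2 W, W \in Omega & A = conj_diag W.
Proof.
move=> CA; have [W [eigW W0 WW]] := normalized_eigenbasis CA.
have uW := eigenbasis_unit injz eigW W0.
move: CA; rewrite inE => /andP[/UgroupP UA _].
have WA : W *m A = D *m W.
  by apply/row_matrixP=> i; rewrite row_mul eigW row_mul row_diag_mx mxE -scalemxAl -rowE.
have [G DG] : exists G, G = W *m J *m dag q W by eexists.
have uG : G \in unitmx by rewrite DG !unitmx_mul uW antidiag_unit dag_unit.
have GD : D *m G *m dag q D = G.
  transitivity (D *m W *m J *m dag q (D *m W)); first by rewrite DG dagM // !mulmxA.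
  transitivity (W *m (A *m J *m dag q A) *m dag q W); last by rewrite UA DG.
  by rewrite -WA dagM // !mulmxA.
(* This replaces hermitian symmetry: the twice-daggered [W] is [W] with permuted rows. Read at (j, s
   j), it gives the relation [gs] required by the rescaling. *)
have Gd : dag q G = perm_mx (sp * sp)%g *m G.
  by rewrite DG !dagM // WW dag_antidiag // !mulmxA.
have Gij i j : i != s j -> G i j = 0.
  move/matrixP: GD => /(_ i j); rewrite diag_dag_entry // !mxE => e.
  apply: contraNeq => Gij0; apply/eqP/injz; rewrite zs /sigma.
  have zq : z j ^+ q != 0 by rewrite expf_neq0.
  apply: (mulIf zq); rewrite mulVf //; apply: (mulIf Gij0).
  by rewrite mul1r -[RHS]e mulrAC.
have g0 j : G (s j) j != 0.
  apply: contraTneq uG => Gj0; rewrite unitmxE (expand_det_col _ j) big1 ?unitr0 //.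
  by move=> i _; case: (eqVneq i (s j)) => [->|/Gij ->]; rewrite ?Gj0 mul0r.
have gs j : G (s (s j)) (s j) = G (s j) j ^+ q.
  move/matrixP: Gd => /(_ j (s j)); rewrite -row_permE [LHS]mxE [in LHS]mxE /bar => ->.
  by rewrite mxE permM !permE.
have [t [t0 ts]] := torus_rescaling g0 gs.
exists (diag_mx (\row_i t i) *m W); last first.
  have ut : diag_mx (\row_i t i) \in unitmx.
    rewrite unitmxE det_diag unitfE; apply/prodf_neq0 => i _; rewrite mxE //.
  apply: (can_inj (mulKmx (_ : diag_mx (\row_i t i) *m W \in unitmx))).
    by rewrite unitmx_mul ut.
  rewrite /conj_diag !mulmxA mulmxV ?unitmx_mul ?ut // mul1mx.
  by rewrite -(mulmxA _ W A) WA !mulmxA diag_mxC.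
apply/OmegaP; transitivity (diag_mx (\row_i t i) *m G *m dag q (diag_mx (\row_i t i))).
  by rewrite DG dagM // !mulmxA.
apply/matrixP=> i j; rewrite diag_dag_entry // twist_mxE !mxE.
by case: eqVneq => [->|/Gij ->]; rewrite ?ts // mulr0 mul0r.
Qed.

Lemma conj_diag_fiber W W' : W \in Omega -> W' \in Omega ->
  (conj_diag W' == conj_diag W) =
  [exists t : 'rV_n, (W' == diag_mx t *m W) && (diag_mx t *m S *m dag q (diag_mx t) == S)].
Proof.
move=> OW OW'; have uW := Omega_unit OW; have uW' := Omega_unit OW'.
apply/eqP/existsP => [E | [t /andP[/eqP -> /eqP Et]]].
  have [||t Wt] := diagonal_of_commute (A := conj_diag W) (B := invmx W *m W') injz uW.
  - by rewrite /conj_diag !mulmxA mulmxV // mul1mx.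
  - rewrite -{2}E /conj_diag !mulmxA -(mulmxA _ W) mulmxV // mulmx1.
    by rewrite -(mulmxA _ W') mulmxV // mulmx1.
  have {}Wt : W' = diag_mx t *m W by rewrite -Wt mulKVmx.
  exists t; rewrite Wt eqxx /=; apply/eqP.
  move/OmegaP: OW' => {2}<-; move/OmegaP: OW => <-.
  by rewrite Wt dagM // !mulmxA.
have ut : diag_mx t \in unitmx.
  rewrite unitmxE det_diag unitfE; apply/prodf_neq0 => i _.
  by case: (twist_torus Et i).
apply: (can_inj (mulKmx (_ : diag_mx t *m W \in unitmx))); first by rewrite unitmx_mul ut.
rewrite /conj_diag !mulmxA mulmxV ?unitmx_mul ?ut // mul1mx.
by rewrite -(mulmxA _ W) mulmxV // mulmx1 diag_mxC.
Qed.

(** Written as the diagonal stabiliser of S, which is the form in which it acts on [Omega];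
    entrywise it says that t is nowhere zero and commutes with sigma. *)
Definition torus : {set 'rV[L]_n} :=
  [set t | diag_mx t *m S *m dag q (diag_mx t) == S].

Lemma card_unitary_class : (#|unitary_class| * #|torus|)%N = #|Ugroup L q n|.
Proof.
rewrite -card_Omega -[RHS]sum1_card (partition_big conj_diag (mem unitary_class)) /=; last first.
  by move=> W; apply: Omega_class.
rewrite -sum_nat_const; apply: eq_bigr => A /conj_diag_surj[W OW ->].
have uW := Omega_unit OW; rewrite sum1dep_card.
have inj : injective (fun t : 'rV[L]_n => diag_mx t *m W).
  by move=> t u /(can_inj (mulmxK uW)) /diag_mx_inj.
rewrite -(card_imset _ inj); apply: eq_card => W'; rewrite inE.
apply/imsetP/andP => [[t Tt ->] | [OW' cW]].
  rewrite inE in Tt; have OtW : diag_mx t *m W \in Omega.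
    move/eqP: Tt => Tt; apply/OmegaP; rewrite -[RHS]Tt; move/OmegaP: OW => <-.
    by rewrite dagM // !mulmxA.
  by split=> //; rewrite conj_diag_fiber //; apply/existsP; exists t; rewrite eqxx.
move: cW; rewrite conj_diag_fiber // => /existsP[t /andP[/eqP -> Tt]].
by exists t; rewrite ?inE.
Qed.

(** An M-th root commutes with [A], hence is diagonal in the basis [W], and it is unitary exactly
    when its diagonal lies in the torus. *)
Lemma Mth_power_class M A : A \in unitary_class ->
  is_Mth_power_U q M A <->
  exists2 t : 'rV_n, t \in torus & forall j, t 0 j ^+ M = z j.
Proof.
case/conj_diag_surj => W OW DA; have uW := Omega_unit OW.
have powW a t k : W *m a = diag_mx t *m W ->
    W *m a ^+ k = diag_mx (\row_j t 0 j ^+ k) *m W.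
  move=> Wa; elim: k => [|k IH].
    rewrite expr0 (_ : diag_mx _ = 1%:M); first by rewrite mul1mx mulmx1.
    by apply/matrixP=> i j; rewrite !mxE expr0.
  rewrite exprS [W *m _]mulmxA Wa -mulmxA IH mulmxA mulmx_diag.
  by congr (diag_mx _ *m _); apply/rowP=> j; rewrite !mxE exprS.
have WA : W *m A = D *m W by rewrite DA /conj_diag !mulmxA mulmxV // mul1mx.
split=> [/existsP[a /andP[Ua /eqP aM]] | [t Tt tM]].
  have [|t Wa] := diagonal_of_commute (B := a) injz uW WA.
    by rewrite -aM -[_ *m a]exprSr -[a *m _]exprS.
  have Da : a = invmx W *m diag_mx t *m W by rewrite -mulmxA -Wa mulKmx.
  exists t; first by rewrite inE; apply/eqP/(Omega_conj_torus _ OW); rewrite -Da inE.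
  have := powW a t M Wa; rewrite aM WA => /(can_inj (mulmxK uW)) /diag_mx_inj /rowP tM j.
  by have := tM j; rewrite !mxE.
pose a := invmx W *m diag_mx t *m W.
have Wa : W *m a = diag_mx t *m W by rewrite /a !mulmxA mulmxV // mul1mx.
apply/existsP; exists a; apply/andP; split.
  suff : a \in Ugroup L q n by rewrite inE.
  by apply/(Omega_conj_torus _ OW)/eqP; rewrite inE in Tt.
apply/eqP/(can_inj (mulKmx uW)); rewrite WA (powW _ _ _ Wa); congr (diag_mx _ *m _).
by apply/rowP=> j; rewrite !mxE.
Qed.
End Omega.

(** * Summing over the sets of eigenvalues *)

Section Classes.
Variables (F L : finFieldType) (iota : {rmorphism F -> L}) (q : nat).
Hypothesis hF : #|F| = (q ^ 2)%N.
Let hq : [pchar L].-nat q := q_pchar_ext hF iota.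
Let q1 : (1 < q)%N := q_gt1 hF.
Local Notation sg := (@sigma L q).
Let injsg : injective sg := sigma_inj hq.

(* x has an M-th root in L fixed by the stabiliser of x in the group generated
   by sigma. *)
Definition has_stable_root (M : nat) (x : L) : bool :=
  [exists mu, (mu ^+ M == x) && (iter (order sg x) sg mu == mu)].

Definition admissible (Z : {set L}) : bool :=
  (0 \notin Z) && [forall x, (sg x \in Z) == (x \in Z)].

Definition sigma_maps (Z : {set L}) : {set {ffun L -> L}} :=
  equivariant_maps sg [set~ 0] 0 Z.

Section OneClass.
Variables (M : nat) (hM : (0 < M)%N) (Z : {set L}).
Local Notation n := #|Z|.
Hypothesis splU : forall d, (0 < d <= n)%N ->
  splits ('X^(q ^ (2 * d) - 1) - 1 : {poly L}).
Hypothesis admZ : admissible Z.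
Local Notation z := (@enum_val L (mem Z)).
Local Notation injz := (@enum_val_inj L (mem Z)).

Lemma admissible_neq0 x : x \in Z -> x != 0.
Proof. by move=> xZ; case/andP: admZ => + _; apply: contraNneq => <-. Qed.

Lemma admissible_stable x : (sg x \in Z) = (x \in Z).
Proof. by case/andP: admZ => _ /forallP/(_ x)/eqP. Qed.

Lemma enum_admissible_neq0 i : z i != 0. Proof. exact: admissible_neq0 (enum_valP i). Qed.

Lemma index_map_exists : exists s : 'I_n -> 'I_n, forall i, z (s i) = sg (z i).
Proof.
suff ex (i : 'I_n) : exists j : 'I_n, z j = sg (z i).
  by have [s zs] := fin_all_exists ex; exists s.
have sZ : sg (z i) \in Z by rewrite admissible_stable enum_valP.
by exists (enum_rank_in sZ (sg (z i))); rewrite enum_rankK_in.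
Qed.

Lemma char_poly_class (A : 'M[L]_n) :
  (A \in unitary_class q z) =
  (A \in Ugroup L q n) && (char_poly A == \prod_(x in Z) ('X - x%:P)).
Proof. by rewrite inE [in RHS]big_enum_val. Qed.

Variables (s : 'I_n -> 'I_n) (zs : forall i, z (s i) = sg (z i)).

Lemma torusP (t : 'rV[L]_n) : t \in torus iota hF injz zs <->
  forall j, t 0 j != 0 /\ t 0 (s j) = sg (t 0 j).
Proof.
rewrite inE; split=> [/eqP/twist_torus //|tP]; apply/eqP/torus_twist => j;
by case: (tP j).
Qed.

Lemma card_torus : #|torus iota hF injz zs| = #|sigma_maps Z|.
Proof.
pose ev (phi : {ffun L -> L}) : 'rV[L]_n := \row_i phi (z i).
rewrite -(card_in_imset (f := ev) (D := sigma_maps Z)); last first.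
  move=> phi psi; rewrite !inE => /forallP Pphi /forallP Ppsi /rowP E.
  apply/ffunP=> x; have := (Pphi x, Ppsi x).
  case: (boolP (x \in Z)) => xZ; last by case=> /eqP-> /eqP->.
  by move=> _; have := E (enum_rank_in xZ x); rewrite !mxE enum_rankK_in.
apply: eq_card => t; apply/idP/imsetP => [/torusP tP | [phi + ->]].
  pose phi := [ffun x => if [pick i | z i == x] is Some i then t 0 i else 0].
  have phiz i : phi (z i) = t 0 i.
    by rewrite ffunE; case: pickP => [j /eqP/injz->|/(_ i)]; rewrite ?eqxx.
  exists phi; last by apply/rowP=> i; rewrite mxE phiz.
  rewrite inE; apply/forallP=> x; case: ifPn => xZ; last first.
    by rewrite ffunE; case: pickP => // i /eqP zi; case/negP: xZ; rewrite -zi enum_valP.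
  have [i ->] : exists i, x = z i.
    by exists (enum_rank_in xZ x); rewrite enum_rankK_in.
  by rewrite -zs !phiz !inE; case: (tP i) => -> ->; rewrite eqxx.
rewrite inE => /forallP phiP; apply/torusP=> j; rewrite !mxE zs.
by have := phiP (z j); rewrite enum_valP !inE => /andP[? /eqP].
Qed.

(** Equivariance makes the value at x return after one turn of the orbit of x, which is stability of
    the root. Conversely, a stable root chosen at one point of each orbit propagates, since sigma
    commutes with M-th powers. *)
Lemma Mth_power_torus :
  (exists2 t : 'rV_n, t \in torus iota hF injz zs & forall j, t 0 j ^+ M = z j) <->
  {in Z, forall x, has_stable_root M x}.
Proof.
split=> [[t /torusP tP tM] x xZ | good].
  have Dx : x = z (enum_rank_in xZ x) by rewrite enum_rankK_in.
  move: (enum_rank_in _ _) Dx => j Dx; apply/existsP; exists (t 0 j).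
  rewrite tM Dx eqxx /=.
  have it k : iter k sg (t 0 j) = t 0 (iter k s j).
    by elim: k => //= k ->; rewrite (tP _).2.
  have itz k : iter k sg (z j) = z (iter k s j) by elim: k => //= k ->; rewrite zs.
  by rewrite it (injz (_ : z (iter (order sg (z j)) s j) = z j)) // -itz iter_order.
have [a aP] : exists a : L -> L, forall x,
    iter (order sg x) sg (a x) = a x /\ (has_stable_root M x -> a x ^+ M = x).
  suff ex (x : L) : exists y : L, iter (order sg x) sg y = y /\ (has_stable_root M x -> y ^+ M = x).
    by have [a aP] := fin_all_exists ex; exists a.
  case: (boolP (has_stable_root M x)) => [|_].
    by case/existsP=> mu /andP[/eqP ? /eqP ?]; exists mu.
  (* Default for points without a stable root: x itself has the right period, which is all the
     closing condition asks. *)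
  by exists x; rewrite iter_order.
have [|t [ta ts]] := equivariant_section injsg (step := fun _ y => sg y) (a := a).
  move=> r _; have it k : iter k (fun u => (sg u.1, sg u.2)) (r, a r) =
    (iter k sg r, iter k sg (a r)) by elim: k => //= k ->.
  by rewrite it (aP r).1 iter_order.
have tM x : x \in Z -> t x ^+ M = x.
  move=> xZ; have rZ k : iter k sg (froot sg x) \in Z -> froot sg x \in Z.
    by elim: k => //= k IH; rewrite admissible_stable.
  have := xZ; rewrite -{1}(iter_froot injsg x) => /rZ {}rZ.
  have ir k y : t (iter k sg y) = iter k sg (t y) by elim: k => //= k <-; rewrite ts.
  rewrite -{1}(iter_froot injsg x) ir ta; last by apply: root_root; apply: fconnect_sym.
  by rewrite -iter_sigmaX ?(aP _).2 ?good // iter_froot.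
exists (\row_i t (z i)); last by move=> j; rewrite mxE tM ?enum_valP.
apply/torusP=> j; rewrite !mxE zs ts; split=> //.
by apply: contraNneq (enum_admissible_neq0 j) => tz; rewrite -(tM (z j)) ?enum_valP // tz expr0n gtn_eqF.
Qed.
End OneClass.

Definition set_class (n : nat) (Z : {set L}) : {set 'M[L]_n} :=
  [set A in Ugroup L q n | char_poly A == \prod_(x in Z) ('X - x%:P)].

Lemma card_class (M n : nat) (Z : {set L}) : (0 < M)%N -> #|Z| = n ->
    (forall d, (0 < d <= n)%N -> splits ('X^(q ^ (2 * d) - 1) - 1 : {poly L})) ->
    admissible Z ->
  (#|set_class n Z| * #|sigma_maps Z|)%N = #|Ugroup L q n| /\
  (forall A : 'M[L]_n, A \in Ugroup L q n -> char_poly A = \prod_(x in Z) ('X - x%:P) ->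
     is_Mth_power_U q M A <-> {in Z, forall x, has_stable_root M x}).
Proof.
move=> M0 <- splU admZ; have [s zs] := index_map_exists admZ.
have z0 := enum_admissible_neq0 admZ; pose injz := @enum_val_inj L (mem Z).
split; last first.
  move=> A UA chA; apply: iff_trans (Mth_power_torus M0 admZ zs).
  by apply: (Mth_power_class iota hF splU injz z0 zs); rewrite ?char_poly_class ?UA ?chA ?eqxx.
have <- : #|torus iota hF injz zs| = #|sigma_maps Z| by apply: card_torus.
rewrite -(card_unitary_class iota hF splU injz z0 zs).
congr (_ * _)%N.
by apply: eq_card => A; rewrite char_poly_class inE.
Qed.

(** If v A = x v, then J v^dagger = A J A^dagger v^dagger = x^q A J v^dagger, so J v^dagger is a
    right eigenvector for sigma x. *)
Lemma unitary_char_poly n (A : 'M[L]_n) :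
    (forall p : {poly F}, p != 0 -> (size p <= n.+1)%N -> splits (map_poly iota p)) ->
    A \in Ugroup L q n -> separable_mx A ->
  let Z := roots_of (char_poly A) in
  [/\ char_poly A = \prod_(x in Z) ('X - x%:P), #|Z| = n & admissible Z].
Proof.
move=> splF UA sepA Z; have uA := Ugroup_unit UA.
have UA' : unitaryb q A by rewrite inE in UA.
have [A' DA] : exists A', A = map_mx iota A' by apply: unitary_descent UA'.
have spl : splits (char_poly A).
  rewrite DA -map_char_poly; apply: splF; last by rewrite size_char_poly.
  exact/monic_neq0/char_poly_monic.
have chA := splits_prod spl sepA (char_poly_monic A).
split=> //; first by rewrite (splits_card spl sepA) size_char_poly.
have st x : x \in Z -> x != 0 /\ sg x \in Z.
  rewrite !inE -eigenvalue_root_char => /eigenvalueP[v vA v0].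
  have x0 : x != 0.
    apply: contraNneq v0 => x0; rewrite -(mulmxK uA v) vA x0 scale0r mul0mx //.
  split=> //; rewrite -char_poly_tr -eigenvalue_root_char.
  pose u := antidiag L n *m dag q v.
  have Au : A *m u = sg x *: u.
    move/UgroupP: UA => UA; rewrite /u -[in RHS]UA -!mulmxA -(dagM hq) vA (dagZ hq).
    by rewrite -!scalemxAr scalerA /sigma mulVf ?scale1r ?expf_neq0.
  apply/eigenvalueP; exists u^T; first by rewrite -trmx_mul Au linearZ.
  apply: contraNneq v0 => u0; have : u = 0 by rewrite -[u]trmxK u0 trmx0.
  rewrite /u => /(congr1 (mulmx (invmx (antidiag L n)))).
  rewrite mulKmx ?antidiag_unit // mulmx0 => d0.
  apply/eqP/rowP=> j; move/colP: d0 => /(_ j); rewrite !mxE => /eqP.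
  by rewrite (fmorph_eq0 (qfrob hq)) => /eqP.
apply/andP; split; first by apply/negP => /st[]; rewrite eqxx.
(* Stability was shown in one direction only; injectivity on a finite set gives the converse. *)
have imZ : sg @: Z = Z.
  apply/eqP; rewrite eqEcard card_imset // leqnn andbT.
  by apply/subsetP=> _ /imsetP[x /st[_ ?] ->].
by apply/forallP=> x; rewrite -{1}imZ mem_imset.
Qed.

(** The M-th power condition depends only on the eigenvalue set, so each class counts entirely or
    not at all. *)
Lemma S_U_ratio (M n : nat) : (0 < M)%N ->
    (forall p : {poly F}, p != 0 -> (size p <= n.+1)%N -> splits (map_poly iota p)) ->
    (forall d, (0 < d <= n)%N -> splits ('X^(q ^ (2 * d) - 1) - 1 : {poly L})) ->
  (S_U F q M n)%:R / #|Ugroup F q n|%:R =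
  \sum_(Z : {set L} | [&& #|Z| == n, admissible Z & Z \subset [set x | has_stable_root M x]])
     (#|sigma_maps Z|%:R)^-1 :> rat.
Proof.
move=> M0 splF splU; rewrite -(S_U_ext iota n hF) -(card_Ugroup_ext iota n hF).
have U0 : (#|Ugroup L q n|%:R : rat) != 0.
  rewrite Num.Theory.pnatr_eq0 -lt0n; apply/card_gt0P; exists 1%:M.
  by apply/UgroupP; rewrite (dag1 hq) mul1mx mulmx1.
rewrite /S_U -sum1_card (partition_big (fun A : 'M[L]_n => roots_of (char_poly A))
   (fun Z => [&& #|Z| == n, admissible Z & Z \subset [set x | has_stable_root M x]])) /=; last first.
  move=> A; rewrite inE => /and3P[UA sepA MA].
  have UA' : A \in Ugroup L q n by rewrite inE.
  have [chA cZ aZ] := unitary_char_poly splF UA' sepA.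
  rewrite cZ eqxx aZ; apply/subsetP=> x xZ; rewrite inE.
  by have [_ MP] := card_class M0 cZ splU aZ; apply: (MP A UA' chA).1.
rewrite natr_sum mulr_suml; apply: eq_bigr => Z /and3P[/eqP cZ aZ gZ].
have [cc MP] := card_class M0 cZ splU aZ.
have -> : (\sum_(A in [set A : 'M[L]_n | [&& unitaryb q A, separable_mx A & is_Mth_power_U q M A]]
     | roots_of (char_poly A) == Z) 1)%N =
  #|set_class n Z|.
  rewrite sum1dep_card; apply: eq_card => A; rewrite !inE.
  apply/andP/andP => [[/and3P[UA sepA MA] /eqP DZ] | [UA /eqP chA]].
    have UA' : A \in Ugroup L q n by rewrite inE.
    by have [chA _ _] := unitary_char_poly splF UA' sepA; rewrite UA {1}chA DZ eqxx.
  have UA' : A \in Ugroup L q n by rewrite inE.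
  rewrite UA chA roots_of_prod eqxx /separable_mx chA separable_prod_set; split=> //=.
  by apply/(MP A UA' chA) => x /(subsetP gZ); rewrite inE.
have := U0; rewrite -cc natrM mulf_eq0 => /norP[c0 m0].
by rewrite invfM mulrA divff // mul1r.
Qed.
End Classes.

(** * Expansion over orbits *)

Lemma coef_prod_1DX (I : finType) (K : comNzRingType) (A : {set I}) (c : I -> K)
    (o : I -> nat) n :
  (\prod_(i in A) (1 + c i *: 'X^(o i)))`_n =
  \sum_(B : {set I} | (B \subset A) && (\sum_(i in B) o i == n)%N) \prod_(i in B) c i.
Proof.
rewrite big_mkcond /=.
(* Indices outside [A] get the factor 0 + 1, so the expansion can run over all subsets, those not
   contained in [A] contributing 0. *)
rewrite (eq_bigr (fun i => (if i \in A then c i *: 'X^(o i) else 0) + 1)); last first.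
  by move=> i _; case: ifP => _; rewrite ?add0r // addrC.
rewrite bigA_distr coef_sum [RHS]big_mkcond; apply: eq_bigr => B _.
case: (boolP (B \subset A)) => [sBA|/subsetPn[i iB iA]] /=; last first.
  by rewrite (bigD1 i) //= iB (negPf iA) mul0r coef0.
rewrite -big_mkcond /=; have -> : \prod_(i in B) (if i \in A then c i *: 'X^(o i) else 0) =
    (\prod_(i in B) c i) *: 'X^(\sum_(i in B) o i) :> {poly K}.
  rewrite -prodrXr -scaler_prod; apply: eq_bigr => i /(subsetP sBA) ->; by [].
by rewrite coefZ coefXn eq_sym; case: eqP => _; rewrite ?mulr1 ?mulr0.
Qed.

Lemma prod_by_value (I : finType) (K : comNzRingType) (A : {set I}) (o : I -> nat)
    (w : nat -> K) N : {in A, forall r, 0 < o r <= N}%N ->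
  \prod_(r in A) w (o r) = \prod_(1 <= d < N.+1) w d ^+ #|[set r in A | o r == d]|.
Proof.
move=> oN; rewrite big_geq_mkord.
rewrite (partition_big (fun r => inord (o r) : 'I_N.+1) (fun d => true && (0 < d)%N)) /=.
  apply: eq_bigr => d _; rewrite -prodr_const; apply: congr_big => // [r|r].
    rewrite inE; apply: andb_id2l => /oN/andP[_ le].
    by rewrite -val_eqE /= inordK.
  by case/andP=> /oN/andP[_ le] /eqP <-; rewrite inordK.
by move=> r /oN/andP[o0 le]; rewrite inordK.
Qed.

Section Generating.
Variables (F L : finFieldType) (iota : {rmorphism F -> L}) (q : nat).
Hypothesis hF : #|F| = (q ^ 2)%N.
Let hq : [pchar L].-nat q := q_pchar_ext hF iota.
Let q1 : (1 < q)%N := q_gt1 hF.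
Local Notation sg := (@sigma L q).
Let injsg : injective sg := sigma_inj hq.
Variables (M n : nat) (hM : (0 < M)%N).
Hypothesis splU : forall d, (0 < d <= n)%N ->
  splits ('X^(q ^ (2 * d) - 1) - 1 : {poly L}).

Lemma iter_period x y k : iter k sg x = y -> exists l, iter l sg y = x.
Proof.
move=> xy; have : fconnect sg y x.
  by rewrite fconnect_sym // -xy fconnect_iter.
by move/iter_findex => <-; exists (findex sg y x).
Qed.

Lemma order_iter k x : order sg (iter k sg x) = order sg x.
Proof.
apply: eq_card => y; rewrite -!topredE /=; apply: esym.
by apply: same_connect; [apply: fconnect_sym | apply: fconnect_iter].
Qed.

Lemma has_stable_root_iter k x : has_stable_root q M (iter k sg x) = has_stable_root q M x.
Proof.
have fwd l y : has_stable_root q M y -> has_stable_root q M (iter l sg y).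
  case/existsP=> mu /andP[/eqP mM /eqP mo]; apply/existsP; exists (iter l sg mu).
  by rewrite -iter_sigmaX mM eqxx order_iter -iterD addnC iterD mo eqxx.
apply/idP/idP; last exact: fwd.
by have [l E] := iter_period (erefl (iter k sg x)) => g; rewrite -E; apply: fwd.
Qed.

Lemma has_stable_root_froot x : has_stable_root q M (froot sg x) = has_stable_root q M x.
Proof. by rewrite -{2}(iter_froot injsg x) has_stable_root_iter. Qed.

(** The size bound mirrors the truncated product: odd sizes d and even sizes 2d with d <= n. Orbits
    of size between n and 2n leave the coefficient of z^n unchanged but are needed to match the
    factors. *)
Definition orbit_reps : {set L} := [set r | [&& r != 0, froot sg r == r, has_stable_root q M r &
  (order sg r <= (if odd (order sg r) then n else 2 * n))%N]].

Definition orbit_union (J : {set L}) : {set L} := [set x | froot sg x \in J].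

Lemma orbit_union_stable J x : (sg x \in orbit_union J) = (x \in orbit_union J).
Proof. by rewrite !inE froot_succ. Qed.

Lemma froot_froot x : froot sg (froot sg x) = froot sg x.
Proof. by apply: root_root; apply: fconnect_sym. Qed.

Lemma froot_eq0 x : (froot sg x == 0) = (x == 0).
Proof. by rewrite -{2}(iter_froot injsg x) iter_sigma_eq0. Qed.

Lemma card_orbit_union (J : {set L}) : {in J, forall r, froot sg r = r} ->
  #|orbit_union J| = (\sum_(r in J) order sg r)%N.
Proof.
move=> rJ; rewrite -sum1_card (partition_big (froot sg) (mem J)) /=; last first.
  by move=> x; rewrite inE.
apply: eq_bigr => r rJ'; rewrite sum1dep_card; apply: eq_card => x.
rewrite !inE; apply/andP/idP => [[_ /eqP <-]|].
  exact: fconnect_froot.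
rewrite -(root_connect (fconnect_sym injsg)) (rJ _ rJ') => /eqP <-.
by rewrite eqxx.
Qed.

Lemma card_sigma_maps_union (J : {set L}) : J \subset orbit_reps ->
  #|sigma_maps q (orbit_union J)| = (\prod_(r in J) torus_order q (order sg r))%N.
Proof.
move=> /subsetP sJ; rewrite card_equivariant_maps //; last 2 first.
- by move=> x; rewrite !inE sigma_eq0.
- exact: orbit_union_stable.
rewrite (eq_bigl (mem J)) => [|r].
  apply: eq_bigr => r /sJ; rewrite inE => /and4P[_ _ _ le].
  by rewrite (card_fixed_iter_sigma hq q1 (natr_q hF iota) splU) // order_gt0.
rewrite !inE /=; apply/andP/idP => [[rJ /eqP <-] //|rJ].
by have := sJ _ rJ; rewrite inE => /and4P[_ /eqP rr _ _]; rewrite rr.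
Qed.

(** Expanding the product chooses a set of orbits; its union is an admissible set whose size is the
    exponent and whose torus order is the product of the denominators. *)
Lemma sum_classes_coef :
  \sum_(Z : {set L} | [&& #|Z| == n, admissible q Z & Z \subset [set x | has_stable_root q M x]])
     (#|sigma_maps q Z|%:R)^-1 =
  (\prod_(r in orbit_reps)
     (1 + (torus_order q (order sg r))%:R^-1 *: 'X^(order sg r)))`_n :> rat.
Proof.
rewrite coef_prod_1DX (reindex_onto orbit_union (fun Z => [set x in Z | froot sg x == x])).
  rewrite (eq_bigl (fun J : {set L} =>
    (J \subset orbit_reps) && (\sum_(r in J) order sg r == n)%N)) => [|J].
    apply: eq_bigr => J /andP[sJ _].
    by rewrite card_sigma_maps_union // natr_prod prodfV.
  apply/andP/andP => [[/and3P[/eqP cJ aJ gJ] /eqP J_eq] | [sJ /eqP oJ]].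
    have rJ : {in J, forall r, froot sg r = r}.
      by move=> r; rewrite -{1}J_eq inE => /andP[_ /eqP].
    have JU r : r \in J -> r \in orbit_union J by move=> ?; rewrite inE rJ.
    rewrite -card_orbit_union // cJ eqxx; split=> //.
    apply/subsetP=> r rJ'; rewrite inE (admissible_neq0 aJ) ?JU // rJ // eqxx.
    have := subsetP gJ r (JU r rJ'); rewrite inE => -> /=.
    have : (order sg r <= n)%N.
      by rewrite -cJ card_orbit_union // (bigD1 r) //= leq_addr.
    by case: ifP => _ //; lia.
  have J_eq : [set x in orbit_union J | froot sg x == x] = J.
    apply/setP=> r; rewrite !inE; apply/andP/idP => [[rJ /eqP <-] //|rJ].
    by have := subsetP sJ _ rJ; rewrite inE => /and4P[_ /eqP rr _ _]; rewrite rr.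
  rewrite J_eq eqxx; split=> //; apply/and3P; split.
  - rewrite card_orbit_union ?oJ // => r rJ.
    by have := subsetP sJ _ rJ; rewrite inE => /and4P[_ /eqP rr _ _].
  - apply/andP; split; last by apply/forallP=> x; rewrite orbit_union_stable.
    rewrite inE; apply/negP=> r0; have := subsetP sJ _ r0.
    by rewrite inE froot_eq0 eqxx.
  apply/subsetP=> x; rewrite !inE => /(subsetP sJ); rewrite inE => /and4P[_ _ g _].
  by rewrite -has_stable_root_froot.
move=> Z /and3P[_ aZ _]; apply/setP=> x; rewrite !inE froot_froot eqxx andbT.
have it k y : (iter k sg y \in Z) = (y \in Z).
  by elim: k => //= k IH; rewrite (admissible_stable aZ).
by rewrite -{2}(iter_froot injsg x) it.
Qed.

Lemma S_U_coef :
    (forall p : {poly F}, p != 0 -> (size p <= n.+1)%N -> splits (map_poly iota p)) ->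
  (S_U F q M n)%:R / #|Ugroup F q n|%:R =
  ((\prod_(1 <= d < n.+1 | odd d)
     (1 + (q%:R ^+ d + 1)^-1 *: 'X^d) ^+ #|[set r in orbit_reps | order sg r == d]|) *
   (\prod_(1 <= d < n.+1)
     (1 + (q%:R ^+ (2 * d) - 1)^-1 *: 'X^(2 * d)) ^+
       #|[set r in orbit_reps | order sg r == (2 * d)%N]|))`_n :> rat.
Proof.
move=> splF; rewrite (S_U_ratio hF hM splF splU) sum_classes_coef; congr (nth 0 (polyseq _) n).
pose w d : {poly rat} := 1 + (torus_order q d)%:R^-1 *: 'X^d.
rewrite -[LHS]/(\prod_(r in orbit_reps) w (order sg r)).
pose A1 := [set r in orbit_reps | odd (order sg r)].
pose A2 := [set r in orbit_reps | ~~ odd (order sg r)].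
have -> : \prod_(r in orbit_reps) w (order sg r) =
    (\prod_(r in A1) w (order sg r)) * (\prod_(r in A2) w (2 * (order sg r)./2)%N).
  rewrite (bigID (fun r => odd (order sg r))) /=; congr GRing.mul.
    by apply: eq_bigl => r; rewrite [in RHS]inE.
  apply: congr_big => // [r|r]; first by rewrite [in RHS]inE.
  by case/andP=> _ /negbTE od; rewrite mul2n -[in LHS](odd_double_half (order sg r)) od.
rewrite (@prod_by_value _ _ A1 (order sg) w n); last first.
  move=> r; rewrite inE => /andP[]; rewrite inE => /and4P[_ _ _ +] od.
  by rewrite od order_gt0.
rewrite (@prod_by_value _ _ A2 (fun r => (order sg r)./2) (fun d => w (2 * d)%N) n).
  congr GRing.mul.
    rewrite [RHS]big_mkcond; apply: eq_bigr => d _; case: (boolP (odd d)) => od.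
      congr (_ ^+ _); first by rewrite /w /torus_order od natrD natrX.
      by apply: eq_card => r; rewrite !inE; case: (eqVneq (order sg r) d) => [->|_]; rewrite ?od ?andbT ?andbF.
    rewrite (_ : [set r in A1 | _] = set0) ?cards0 ?expr0 //.
    by apply/setP=> r; rewrite !inE; case: (eqVneq (order sg r) d) => [->|_]; rewrite ?(negPf od) ?andbF.
  apply: eq_bigr => d _; congr (_ ^+ _).
    have o2 : odd (2 * d) = false by lia.
    by rewrite /w /torus_order o2 natrB ?natrX // expn_gt0 ltnW.
  apply: eq_card => r; rewrite [LHS]inE [X in X && _]inE [RHS]inE -andbA; congr andb.
  by move: (order sg r) => m; lia.
move=> r; rewrite inE => /andP[]; rewrite inE => /and4P[_ _ _ +] od.
rewrite (negPf od); have := order_gt0 sg r; move: (order sg r) od => m od.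
by lia.
Qed.
End Generating.

(** * Minimal polynomials over F *)

Lemma iter_order_dvd (T : finType) (f : T -> T) (injf : injective f) k x :
  (iter k f x == x) = (order f x %| k)%N.
Proof.
have itm l : iter (l * order f x) f x = x.
  by elim: l => [|l IH] //; rewrite mulSn iterD IH iter_order.
rewrite {1}(divn_eq k (order f x)) addnC iterD itm /dvdn.
apply/eqP/eqP => [E|-> //].
have lt : (k %% order f x < order f x)%N by rewrite ltn_mod order_gt0.
by have := findex_iter lt; rewrite E findex0.
Qed.

Section MinPoly.
Variables (F L : finFieldType) (iota : {rmorphism F -> L}) (q : nat).
Hypothesis hF : #|F| = (q ^ 2)%N.
Let hq : [pchar L].-nat q := q_pchar_ext hF iota.
Let q1 : (1 < q)%N := q_gt1 hF.
Local Notation sg := (@sigma L q).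
Let injsg : injective sg := sigma_inj hq.
Local Notation "p ^iota" := (map_poly iota p) (at level 2, format "p ^iota").

(** This is the Frobenius x -> x^(q^2) of [L] over [F], written as sigma twice so that its orbits
    can be compared with those of sigma. *)
Definition frob2 (x : L) : L := sg (sg x).
Local Notation rho := frob2.

Lemma frob2_inj : injective rho.
Proof. by move=> x y /injsg/injsg. Qed.

Lemma frob2E x : rho x = (qfrob hq \o qfrob hq) x.
Proof. by rewrite /= /qfrob /bar /frob2 sigma2 -exprM mulnn. Qed.

Lemma iter_frob2 k x : iter k rho x = iter (2 * k) sg x.
Proof. by elim: k => // k IH; rewrite mulnS iterD iterS IH. Qed.

Lemma frob2_iota a : rho (iota a) = iota a.
Proof. by rewrite /frob2 sigma2 -rmorphXn -hF expf_card. Qed.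

Lemma root_frob2 (p : {poly F}) x : root p^iota (rho x) = root p^iota x.
Proof.
rewrite frob2E -[in RHS](fmorph_root (qfrob hq \o qfrob hq)).
congr (root _ _); rewrite -map_poly_comp; apply: eq_map_poly => a /=.
by rewrite -[RHS]/((qfrob hq \o qfrob hq) (iota a)) -frob2E frob2_iota.
Qed.

Lemma root_iter_frob2 (p : {poly F}) k x : root p^iota (iter k rho x) = root p^iota x.
Proof. by elim: k => //= k <-; rewrite root_frob2. Qed.

Definition frob2_orbit (x : L) : {set L} := [set y | fconnect rho x y].

(** Frobenius permutes the linear factors, so it fixes the coefficients, which then lie in [F]. *)
Lemma frob2_orbit_descent x : exists f : {poly F},
  f^iota = \prod_(y in frob2_orbit x) ('X - y%:P).
Proof.
have [i|f Df] := @poly_descent F L iota q hF (\prod_(y in frob2_orbit x) ('X - y%:P)).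
  set p := \prod_(y in _) _; rewrite -sigma2 -/(rho _) frob2E -coef_map.
  congr (nth 0 (polyseq _) i); rewrite rmorph_prod /= [RHS](reindex_inj frob2_inj) /=.
  apply: congr_big => // [y|y _].
    by rewrite !inE; apply: same_connect_r; [apply: fconnect_sym; apply: frob2_inj | apply: fconnect1].
  by rewrite rmorphB /= map_polyX map_polyC /= frob2E.
by exists f.
Qed.

Definition orbit_minpoly (x : L) : {poly F} := projT1 (cid (frob2_orbit_descent x)).

Lemma minpolyE x : (orbit_minpoly x)^iota = \prod_(y in frob2_orbit x) ('X - y%:P).
Proof. by rewrite /orbit_minpoly; case: cid. Qed.

Lemma size_minpoly x : size (orbit_minpoly x) = (order rho x).+1.
Proof.
rewrite -(size_map_poly iota) minpolyE size_prod_set; congr _.+1.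
by rewrite cardsE.
Qed.

Lemma monic_minpoly x : orbit_minpoly x \is monic.
Proof. by rewrite -(map_monic iota) minpolyE monic_prod_XsubC. Qed.

Lemma root_minpoly x y : root (orbit_minpoly x)^iota y = fconnect rho x y.
Proof. by have := roots_of_prod (frob2_orbit x); rewrite -minpolyE => /setP/(_ y); rewrite !inE. Qed.

Lemma minpoly_dvd x (p : {poly F}) : root p^iota x -> orbit_minpoly x %| p.
Proof.
move=> px; rewrite -(dvdp_map iota) minpolyE -big_enum /=; apply: uniq_roots_dvdp.
  apply/allP=> y; rewrite mem_enum inE => /iter_findex <-.
  by rewrite root_iter_frob2.
by rewrite uniq_rootsE enum_uniq.
Qed.

Lemma minpoly_eq x y : (orbit_minpoly x == orbit_minpoly y) = fconnect rho x y.
Proof.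
apply/eqP/idP => [E | xy]; first by rewrite -root_minpoly E root_minpoly connect0.
apply: (map_poly_inj iota); rewrite !minpolyE; apply: eq_bigl => u; rewrite !inE.
by apply: same_connect xy _; apply: fconnect_sym; apply: frob2_inj.
Qed.

Lemma minpoly_splits x : splits (orbit_minpoly x)^iota.
Proof. by exists (enum (frob2_orbit x)); rewrite big_enum minpolyE eqpxx. Qed.

Lemma minpoly_irreducible x : irreducible_poly (orbit_minpoly x).
Proof.
split=> [|g g1 gx]; first by rewrite size_minpoly ltnS order_gt0.
have [y gy] : exists y, root g^iota y.
  apply: splits_root; last by rewrite size_map_poly.
  by apply: splits_dvd (minpoly_splits x) _; rewrite dvdp_map.
have xy : root (orbit_minpoly x)^iota y by apply: root_dvdp gy; rewrite dvdp_map.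
rewrite /eqp gx /= (_ : orbit_minpoly x = orbit_minpoly y) ?minpoly_dvd //.
by apply/eqP; rewrite minpoly_eq -root_minpoly.
Qed.

Lemma irreducible_minpoly (f : {poly F}) : irreducible_poly f -> f \is monic ->
  splits f^iota -> exists2 x, f = orbit_minpoly x & root f^iota x.
Proof.
move=> [f1 irf] mon spl; have [|x fx] := splits_root spl.
  by rewrite size_map_poly gtn_eqF.
exists x => //; apply/eqP; rewrite -eqp_monic ?monic_minpoly // eqp_sym.
by apply: irf (minpoly_dvd fx); rewrite size_minpoly eqSS gtn_eqF ?order_gt0.
Qed.

(** On a cycle of odd size the square of sigma is still transitive; on one of even size it has two
    orbits. This is the dichotomy between SCIM polynomials and pairs. *)
Lemma order_frob2 x : order rho x =
  if odd (order sg x) then order sg x else (order sg x)./2.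
Proof.
have E k : (order rho x %| k)%N = (order sg x %| 2 * k)%N.
  by rewrite -!iter_order_dvd // ?iter_frob2 //; apply: frob2_inj.
apply/eqP; rewrite eqn_dvd E; case: (boolP (odd _)) => om.
  by rewrite dvdn_mull //= -(@Gauss_dvdr _ 2) ?coprimen2 // -E dvdnn.
have m2 : (2 * (order sg x)./2)%N = order sg x by rewrite mul2n even_halfK.
rewrite m2 dvdnn /=; have := E (order rho x); rewrite dvdnn -{1}m2 dvdn_pmul2l //.
Qed.

(** For odd orbit size m, sigma x equals the (m+1)-st iterate, an even one; conversely an even
    iterate equal to sigma x makes m divide an odd number. *)
Lemma fconnect_frob2_sigma x : fconnect rho x (sg x) = odd (order sg x).
Proof.
apply/idP/idP => [/iter_findex | om].
  move: (findex _ _ _) => [|k]; rewrite iter_frob2 => /eqP.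
    rewrite eq_sym -[sg x]/(iter 1 sg x) iter_order_dvd // dvdn1 => /eqP -> //.
  rewrite mulnS iterS (inj_eq injsg) iter_order_dvd // => /dvdn_odd; apply; lia.
have -> : sg x = iter (order sg x).+1 sg x by rewrite iterS iter_order.
have -> : (order sg x).+1 = (2 * (order sg x).+1./2)%N by lia.
by rewrite -iter_frob2 fconnect_iter.
Qed.

Lemma minpoly_coef0 x : ((orbit_minpoly x)`_0 != 0) = (x != 0).
Proof.
have -> : ((orbit_minpoly x)`_0 == 0) = root (orbit_minpoly x)^iota 0.
  by rewrite /root horner_coef0 coef_map fmorph_eq0.
rewrite root_minpoly; congr negb; apply/idP/eqP => [/iter_findex|->]; last exact: connect0.
by rewrite iter_frob2 => /eqP; rewrite iter_sigma_eq0 // => /eqP.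
Qed.

Lemma size_ptilde (f : {poly F}) : f \is monic -> f`_0 != 0 -> size (ptilde q f) = size f.
Proof.
move=> mon f0; rewrite /ptilde size_scale ?invr_eq0 ?expf_neq0 //.
rewrite size_poly_eq // subnn /bar expf_neq0 //.
Qed.

Lemma monic_ptilde (f : {poly F}) : f \is monic -> f`_0 != 0 -> ptilde q f \is monic.
Proof.
move=> mon f0; rewrite monicE lead_coefE size_ptilde // coefZ coef_poly.
have fn0 : (0 < size f)%N by rewrite size_poly_gt0 monic_neq0.
by rewrite prednK // leqnn subnn mulVf // expf_neq0.
Qed.

(** Up to nonzero factors the value at x is the sum of f_i^q x^(-i). Its q-th power is the sum of
    f_i x^(-q i), because f_i^(q^2) = f_i, and this is the value of f at sigma x. *)
Lemma root_ptilde (f : {poly F}) x : f`_0 != 0 -> f \is monic -> x != 0 ->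
  root (ptilde q f)^iota x = root f^iota (sg x).
Proof.
move=> f0 mon x0; have fn0 : (0 < size f)%N by rewrite size_poly_gt0 monic_neq0.
rewrite /root /ptilde map_polyZ hornerZ mulf_eq0 fmorph_eq0 invr_eq0 expf_eq0 (negPf f0) andbF /=.
set p := \poly_(i < _) _.
have szp : (size p <= size f)%N by apply: size_poly.
have Ep : p^iota.[x] = x ^+ (size f).-1 * \sum_(i < size f) (iota f`_i) ^+ q * x ^- i.
  rewrite (horner_coef_wide _ (n := size f)) ?size_map_poly // (reindex_inj rev_ord_inj) mulr_sumr /=.
  apply: eq_bigr => i _; rewrite coef_map coef_poly.
  have lti := ltn_ord i.
  have -> : ((size f - i.+1) < size f)%N by lia.
  have sub2 m k : (k < m)%N -> (m.-1 - (m - k.+1) = k)%N by lia.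
  have addk m k : (k < m)%N -> (m.-1 = (m - k.+1) + k)%N by lia.
  rewrite sub2 //.
  rewrite /bar -(rmorphXn iota) mulrCA; congr (_ * _).
  by rewrite (addk _ _ lti) exprD mulfK ?expf_neq0.
rewrite Ep mulf_eq0 expf_eq0 (negPf x0) andbF /= -(fmorph_eq0 (qfrob hq)).
rewrite rmorph_sum (horner_coef_wide _ (n := size f)) ?size_map_poly //.
congr (_ == 0); apply: eq_bigr => i _.
rewrite rmorphM coef_map /= /qfrob /bar -rmorphXn -rmorphXn -exprM mulnn -hF expf_card.
by rewrite /sigma !exprVn -!exprM mulnC.
Qed.

Lemma ptilde_minpoly x : x != 0 -> ptilde q (orbit_minpoly x) = orbit_minpoly (sg x).
Proof.
move=> x0; have fx0 : (orbit_minpoly x)`_0 != 0 by rewrite minpoly_coef0.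
have sx0 : sg x != 0 by rewrite sigma_eq0.
have dv : orbit_minpoly (sg x) %| ptilde q (orbit_minpoly x).
  by apply: minpoly_dvd; rewrite root_ptilde ?monic_minpoly // root_minpoly fconnect1.
apply/esym/eqP; rewrite -eqp_monic ?monic_minpoly ?monic_ptilde ?monic_minpoly //.
rewrite -(dvdp_size_eqp dv) size_ptilde ?monic_minpoly // !size_minpoly !order_frob2.
by rewrite (order_iter iota hF 1).
Qed.

Lemma SCIM_minpoly x : x != 0 -> SCIM q (orbit_minpoly x) <-> odd (order sg x).
Proof.
move=> x0; rewrite -fconnect_frob2_sigma -minpoly_eq eq_sym.
split=> [[_ _ _] | /eqP E]; first by rewrite ptilde_minpoly // => ->.
by split; rewrite ?monic_minpoly ?minpoly_coef0 ?ptilde_minpoly //; apply: minpoly_irreducible.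
Qed.

Lemma minpoly_dvd_comp_Xn M x y : x ^+ M = y -> orbit_minpoly x %| orbit_minpoly y \Po 'X^M.
Proof.
move=> xy; apply: minpoly_dvd; rewrite map_comp_poly map_polyXn /root horner_comp hornerXn xy.
by have := root_minpoly y y; rewrite connect0 /root.
Qed.

Lemma comp_Xn_root M (f g : {poly F}) x : g %| f \Po 'X^M -> root g^iota x ->
  root f^iota (x ^+ M).
Proof.
move=> gf gx; have : root (f \Po 'X^M)^iota x by apply: root_dvdp gx; rewrite dvdp_map.
by rewrite map_comp_poly map_polyXn /root horner_comp hornerXn.
Qed.
End MinPoly.

(** * Orbits and polynomials *)

Section Counting.
Variables (F L : finFieldType) (iota : {rmorphism F -> L}) (q : nat).
Hypothesis hF : #|F| = (q ^ 2)%N.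
Let hq : [pchar L].-nat q := q_pchar_ext hF iota.
Local Notation sg := (@sigma L q).
Let injsg : injective sg := sigma_inj hq.
Local Notation rho := (@frob2 L q).
Local Notation minp := (orbit_minpoly iota hF).
Local Notation "p ^iota" := (map_poly iota p) (at level 2, format "p ^iota").
Variables (M n : nat) (hM : (0 < M)%N).
Hypothesis splF : forall p : {poly F}, p != 0 -> (size p <= n.+1)%N -> splits p^iota.
Local Notation reps := (orbit_reps L q M n).

Lemma stable_root_of_root x y : y ^+ M \in frob2_orbit q x -> order sg y = order sg x ->
  has_stable_root q M x.
Proof.
rewrite inE => /iter_findex; move: (findex _ _ _) => k Dk oy.
rewrite -(has_stable_root_iter iota hF M (2 * k)) -iter_frob2 Dk.
apply/existsP; exists y; rewrite eqxx /= -Dk iter_frob2 (order_iter iota hF).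
by rewrite -oy iter_order.
Qed.

(** Stability makes the order of y divide that of x, and x = y^M makes the order of x divide that of
    y. *)
Lemma stable_root_order x : has_stable_root q M x -> exists2 y, y ^+ M = x & order sg y = order sg x.
Proof.
case/existsP=> y /andP[/eqP yM oy]; exists y => //; apply/eqP; rewrite eqn_dvd.
rewrite -(iter_order_dvd injsg) oy -(iter_order_dvd injsg) -{1}yM iter_sigmaX.
by rewrite iter_order ?yM ?eqxx.
Qed.

Lemma minp_neq0 x : (minp x)`_0 != 0 -> x != 0. Proof. by rewrite minpoly_coef0. Qed.

Lemma irreducible_minp (f : {poly F}) : irreducible_poly f -> f \is monic ->
  (size f <= n.+1)%N -> exists x, f = minp x.
Proof.
move=> irf mon sz; have [|x -> _] := irreducible_minpoly hF irf mon _ (iota := iota); last by exists x.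
by apply: splF => //; apply: monic_neq0.
Qed.

(** On the SCIM side degree equals orbit size, so a SCIM factor of equal degree is the minimal
    polynomial of a y with an orbit as long as that of x. *)
Lemma tildeM_power_minp x : x != 0 -> odd (order sg x) -> (order sg x <= n)%N ->
  tildeM_power q M (minp x) <-> has_stable_root q M x.
Proof.
move=> x0 ox len; split=> [[g [Sg szg gf]] | /stable_root_order[y yM oy]].
  have [mon g0 irg _] := Sg.
  have szgn : (size g <= n.+1)%N by rewrite szg size_minpoly (order_frob2 iota hF) ox ltnS.
  have [y Dg] := irreducible_minp irg mon szgn; rewrite {}Dg in Sg szg gf g0.
  have y0 := minp_neq0 g0; have oy := (SCIM_minpoly iota hF y0).1 Sg.
  apply: (@stable_root_of_root x y).
    rewrite inE -(root_minpoly iota hF); apply: comp_Xn_root gf _.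
    by rewrite root_minpoly connect0.
  by move/eqP: szg; rewrite !size_minpoly eqSS !(order_frob2 iota hF) ox oy => /eqP.
have y0 : y != 0 by apply: contraNneq x0 => y0; rewrite -yM y0 expr0n gtn_eqF.
exists (minp y); split; last exact: minpoly_dvd_comp_Xn.
  by apply/SCIM_minpoly; rewrite ?oy.
by rewrite !size_minpoly !(order_frob2 iota hF) oy.
Qed.

Lemma M_power_poly_minp x : x != 0 -> ~~ odd (order sg x) ->
  (order sg x <= 2 * n)%N -> M_power_poly M (minp x) <-> has_stable_root q M x.
Proof.
move=> x0 ox len; split=> [[h [irh szh hf]] | /stable_root_order[y yM oy]].
  have lc0 : lead_coef h != 0.
    by rewrite lead_coef_eq0 -size_poly_gt0 (ltn_trans _ irh.1).
  (* The factor [h] is not assumed monic, whereas minimal polynomials are. *)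
  pose g := (lead_coef h)^-1 *: h.
  have gh : g %= h by apply: eqp_scale; rewrite invr_eq0.
  have mon : g \is monic by rewrite monicE lead_coefZ mulVf.
  have szg : size g = size h by apply: eqp_size.
  have irg : irreducible_poly g.
    split=> [|p p1 pg]; first by rewrite szg irh.1.
    have ph : p %= h by apply: irh.2; rewrite // -(eqp_dvdr _ gh).
    by apply: eqp_trans ph _; rewrite eqp_sym.
  have szgn : (size g <= n.+1)%N.
    by rewrite szg szh size_minpoly (order_frob2 iota hF) (negPf ox) ltnS; lia.
  have gf : g %| minp x \Po 'X^M by rewrite (eqp_dvdl _ gh).
  have [y Dg] := irreducible_minp irg mon szgn; rewrite {}Dg in szg gf.
  have yx : y ^+ M \in frob2_orbit q x.
    rewrite inE -(root_minpoly iota hF); apply: comp_Xn_root gf _.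
    by rewrite root_minpoly connect0.
  apply: (stable_root_of_root yx).
  (* Degree alone leaves two options for the orbit size of y: an odd degree d could come from size d
     or 2d. Divisibility by the even order of x rules out the odd one. *)
  have : (order sg x %| order sg y)%N.
    move: yx; rewrite inE => /iter_findex; move: (findex _ _ _) => k Dk.
    rewrite -(order_iter iota hF (2 * k) x) -iter_frob2 Dk -iter_order_dvd //.
    by rewrite iter_sigmaX iter_order.
  move/eqP: szg; rewrite szh !size_minpoly eqSS !(order_frob2 iota hF) (negPf ox) => /eqP E.
  have o0 := order_gt0 sg x.
  case: ifP E => [oy E | oy E] dv; last by lia.
  by have := dvdn_leq (order_gt0 sg y) dv; lia.
exists (minp y); split; last exact: minpoly_dvd_comp_Xn.
  exact: minpoly_irreducible.
by rewrite !size_minpoly !(order_frob2 iota hF) oy.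
Qed.

Definition rep_of_order m := [set r in reps | order sg r == m].

Lemma rep_of_orderP m r : (m <= (if odd m then n else 2 * n))%N ->
  reflect [/\ r != 0, froot sg r = r, has_stable_root q M r & order sg r = m] (r \in rep_of_order m).
Proof.
move=> lem; rewrite !inE; apply: (iffP andP) => [[/and4P[? /eqP ? ? _] /eqP]|[r0 rr gr or]] //.
by rewrite r0 rr gr or !eqxx lem.
Qed.

Lemma froot_rep m x : (m <= (if odd m then n else 2 * n))%N -> x != 0 ->
  has_stable_root q M x -> order sg x = m -> froot sg x \in rep_of_order m.
Proof.
move=> lem x0 gx ox; apply/rep_of_orderP => //.
by rewrite (froot_eq0 iota hF) (froot_froot iota hF) (has_stable_root_froot iota hF) (order_froot injsg).
Qed.

Lemma frob2_froot x y : fconnect rho x y -> froot sg x = froot sg y.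
Proof.
move/iter_findex; move: (findex _ _ _) => k <-.
by rewrite iter_frob2; elim: (2 * k)%N => //= l ->; rewrite froot_succ.
Qed.

Lemma minp_froot x : odd (order sg x) -> minp (froot sg x) = minp x.
Proof.
rewrite -{1 3}(iter_froot injsg x); elim: (findex sg _ x) => //= k IH.
rewrite -iterS (order_iter iota hF) => or.
rewrite IH ?(order_iter iota hF) //; apply/eqP.
by rewrite minpoly_eq (fconnect_frob2_sigma iota hF) (order_iter iota hF).
Qed.

(** All points of an odd orbit are conjugate over [F], so orbits of size d correspond to single
    minimal polynomials. *)
Lemma Ntilde_reps d : odd d -> (d <= n)%N -> Ntilde F q M d = #|rep_of_order d|.
Proof.
move=> od led; have lem : (d <= (if odd d then n else 2 * n))%N by rewrite od.
pose T x := tuple_of_poly d (minp x).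
have TK x : order sg x = d -> monic_of (T x) = minp x.
  by move=> ox; rewrite tuple_of_polyK ?monic_minpoly // size_minpoly (order_frob2 iota hF) ox od.
rewrite -(card_in_imset (f := T)) => [|x y /(rep_of_orderP _ lem)[_ xx _ ox]
    /(rep_of_orderP _ lem)[_ yy _ oy] E]; last first.
  rewrite -xx -yy; apply: frob2_froot; rewrite -(minpoly_eq iota hF).
  by rewrite -!TK // E.
apply: eq_card => t; rewrite inE; apply/asboolP/imsetP => [[St Tt] | [r]].
  have [mon t0 irt _] := St.
  have [|x Dx] := irreducible_minp irt mon; first by rewrite size_monic_of ltnS.
  rewrite Dx in St Tt t0; have x0 := minp_neq0 t0.
  have ox := (SCIM_minpoly iota hF x0).1 St.
  have oxd : order sg x = d.
    by have := size_monic_of t; rewrite Dx size_minpoly (order_frob2 iota hF) ox => -[].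
  exists (froot sg x); first by apply: froot_rep => //; apply/tildeM_power_minp; rewrite ?oxd.
  by rewrite /T minp_froot // -Dx monic_ofK.
case/(rep_of_orderP _ lem)=> r0 rr gr or ->; rewrite TK //.
by split; [apply/SCIM_minpoly; rewrite ?or | apply/tildeM_power_minp; rewrite ?or].
Qed.

(** An orbit of size 2d splits into the conjugates of r and those of sigma r, with minimal
    polynomials g and [ptilde q g]. Moving along the orbit swaps the two, so the unordered pair
    [P r] is an invariant of the orbit. *)
Lemma Rtilde_reps d : (0 < d <= n)%N -> Rtilde F q M d = #|rep_of_order (2 * d)|.
Proof.
case/andP=> d0 led; have od : odd (2 * d) = false by lia.
have lem : (2 * d <= (if odd (2 * d) then n else 2 * n))%N by rewrite od leq_mul2l.
pose T x := tuple_of_poly d (minp x).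
have TK x : order sg x = (2 * d)%N -> monic_of (T x) = minp x.
  move=> ox; rewrite tuple_of_polyK ?monic_minpoly // size_minpoly (order_frob2 iota hF) ox od.
  by congr _.+1; lia.
have osg x : order sg (sg x) = order sg x := order_iter iota hF 1 x.
pose P x := [set T x; T (sg x)].
have Psg x : P (sg x) = P x.
  rewrite /P setUC; congr ([set _] :|: _); congr (tuple_of_poly d _).
  by apply/eqP; rewrite eq_sym minpoly_eq; apply: fconnect1.
have Pfroot x : P (froot sg x) = P x.
  by rewrite -{2}(iter_froot injsg x); elim: (findex _ _ _) => //= k ->; rewrite Psg.
rewrite -(card_in_imset (f := P)) => [|x y /(rep_of_orderP _ lem)[_ xx _ ox]
    /(rep_of_orderP _ lem)[_ yy _ oy] E]; last first.
  have TP : T x \in P y by rewrite -E !inE eqxx.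
  suff : froot sg x = froot sg y by rewrite xx yy.
  move: TP; rewrite !inE => /orP[] /eqP /(congr1 (@monic_of F d)).
    by rewrite !TK // => /eqP; rewrite minpoly_eq; apply: frob2_froot.
  rewrite !TK ?osg // => /eqP; rewrite minpoly_eq => /frob2_froot.
  by rewrite froot_succ.
apply: eq_card => B; apply/imsetP/imsetP => [[t + ->] | [r /(rep_of_orderP _ lem)[r0 rr gr or] ->]].
  rewrite inE => /asboolP[irt t0 nt Mt].
  have [|x Dx] := irreducible_minp irt (monic_of_monic t).
    by rewrite size_monic_of ltnS.
  rewrite Dx in t0 nt Mt *; have x0 := minp_neq0 t0.
  have ox : ~~ odd (order sg x).
    by rewrite -(fconnect_frob2_sigma iota hF) -(minpoly_eq iota hF) -ptilde_minpoly.
  have oxd : order sg x = (2 * d)%N.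
    have := size_monic_of t; rewrite Dx size_minpoly (order_frob2 iota hF) (negPf ox) => -[].
    by lia.
  exists (froot sg x); last by rewrite Pfroot ptilde_minpoly // /P /T -Dx monic_ofK.
  apply: froot_rep => //; apply/M_power_poly_minp => //.
  by rewrite oxd leq_mul2l.
exists (T r); last by rewrite TK // ptilde_minpoly.
rewrite inE TK //; apply/asboolP; split.
- exact: minpoly_irreducible.
- by rewrite minpoly_coef0.
- by rewrite ptilde_minpoly // minpoly_eq (fconnect_frob2_sigma iota hF) or od.
- by apply/M_power_poly_minp; rewrite ?or ?od // leq_mul2l.
Qed.
End Counting.

Theorem theorem4p4 (F : finFieldType) (q M : nat)
  (hF : #|F| = (q ^ 2)%N) (hM : (2 <= M)%N) :
  forall n : nat, lhs_coef F q M n = (rhs_trunc F q M n)`_n.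
Proof.
case=> [|n]; first by rewrite /rhs_trunc !big_geq // mulr1 coef1.
have M0 : (0 < M)%N by apply: ltnW.
(* The field may depend on the degree because one coefficient is compared at a time. *)
have [L [iota [splF splU]]] := extension_exists hF n.+1.
rewrite /lhs_coef /= (S_U_coef hF M0 splU splF); congr (nth 0 (polyseq _) n.+1).
congr GRing.mul; first apply: congr_big_nat => // d /and3P[od d0 dn];
  last apply: eq_big_nat => d dn.
  by rewrite (Ntilde_reps hF M0 splF).
by rewrite (Rtilde_reps hF M0 splF).
Qed.
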